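(* Let $n\ge 2$, $d\ge 1$, let $k\ge 0$ be an integer, let $\Omega\subset\mathbb{R}^d$ be compact, and let $G$ be a compact (Lie) group that acts on $[n]=\{1,\dots,n\}$. Let $f:\Omega^n\to\mathbb{R}$ be $G$-invariant and $\mathcal{C}^k$. Then for every $\epsilon>0$ there exists a $G$-invariant polynomial $P$ (a real polynomial in the $dn$ coordinates of $(\mathbb{R}^d)^n$) such that $$\|f-P\|_{\mathcal{C}^k(\Omega^n)}<\epsilon .$$
   Context: Points of $(\mathbb{R}^d)^n$ are written $\boldsymbol{x}=(\boldsymbol{x}_1,\dots,\boldsymbol{x}_n)$ with $\boldsymbol{x}_i\in\mathbb{R}^d$. For $\sigma\in G$ (acting on $[n]$), $\sigma.\boldsymbol{x}:=(\boldsymbol{x}_{\sigma(1)},\dots,\boldsymbol{x}_{\sigma(n)})$. A function $f$ is $G$-invariant if $f(\sigma.\boldsymbol{x})=f(\boldsymbol{x})$ for all $\sigma\in G$ and all $\boldsymbol{x}$ in its domain. For compact $V\subset(\mathbb{R}^d)^n$, pick any open set $U$ with $V\subset U\subseteq(\mathbb{R}^d)^n$ and put $\mathcal{C}^k(V)=\{F|_V: F\in\mathcal{C}^k(U)\}$, where $\mathcal{C}^k(U)$ is the set of $k$ times continuously differentiable real functions on $U$; this space is regarded as independent of the choice of $U$. The norm is given by the maxima of the continuous derivatives up to order $k$, restricted to $V$: $$\|p\|_{\mathcal{C}^k(V)}:=\sum_{|\alpha|\le k}\max_{\boldsymbol{x}\in V}|(D^\alpha p)(\boldsymbol{x})|,$$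 with $\alpha\in\mathbb{Z}_{\ge0}^{dn}$ a multi-index.
   Formalization: For general compact Ω the derivatives on Ω^n are not determined by f (e.g. Ω={0}), so the C^k(Ω^n) norm is taken as the infimum, over all C^k extensions, of the sum of maxima; it is the stated norm whenever values on Ω^n determine the derivatives. *)

(* Defs.v *)
From HB Require Import structures.
From mathcomp Require Import all_boot all_order all_algebra.
From mathcomp Require Import all_classical all_reals all_analysis.
(* A full Import would make the notations clash with MathComp-Analysis. *)
From mathcomp Require Import (canonicals, coercions) mpoly.

Set Implicit Arguments.
Unset Strict Implicit.
Unset Printing Implicit Defensive.

Import Order.TTheory GRing.Theory Num.Theory.
Import numFieldNormedType.Exports.

Local Open Scope classical_set_scope.
Local Open Scope ring_scope.

(* No separation axiom is required, so every compact Lie group is an instance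
   of a compact topological group in this sense. *)
HB.mixin Record isTopologicalGroup G of Topological G & Group G := {
  mulg_continuous : continuous (fun gh : G * G => (gh.1 * gh.2)%g) ;
  invg_continuous : continuous (fun g : G => (g^-1)%g)
}.

#[short(type="topologicalGroupType")]
HB.structure Definition TopologicalGroup :=
  {G of isTopologicalGroup G & Topological G & Group G}.

Record is_group_action (G : groupType) (T : Type) (act : G -> T -> T) : Prop :=
  IsGroupAction {
    act_one : forall i, act 1%g i = i ;
    act_mul : forall g h i, act (g * h)%g i = act g (act h i)
  }.

(* A point of (R^d)^n is an n x d matrix x whose i-th row is x_i. *)

Section Points.
Context {R : realType} {n d : nat}.
Implicit Types (x : 'M[R]_(n, d)) (F p : 'M[R]_(n, d) -> R).
Implicit Types (U V : set 'M[R]_(n, d)) (k : nat).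

Definition set_pow (Omega : set 'rV[R]_d) : set 'M[R]_(n, d) :=
  [set x | forall i, Omega (row i x)].

(* rowsub (act g) x is the point (x_{g(1)}, ..., x_{g(n)}). *)
Definition G_invariant (G : groupType) (act : G -> 'I_n -> 'I_n) V p : Prop :=
  forall g x, V x -> p (rowsub (act g) x) = p x.

(* The dn coordinates are numbered by 'I_(n * d), as in mxvec. *)
Definition poly_fun (P : mpoly.mpoly (n * d) R) : 'M[R]_(n, d) -> R :=
  fun x => mpoly.meval (fun l => mxvec x 0 l) P.

Definition coord_dir (l : 'I_(n * d)) : 'M[R]_(n, d) := vec_mx (delta_mx 0 l).

Definition partial (l : 'I_(n * d)) F : 'M[R]_(n, d) -> R :=
  'D_(coord_dir l) F.

Definition mderiv (a : mpoly.multinom (n * d)) F : 'M[R]_(n, d) -> R :=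
  foldr (fun l => iter (a l) (partial l)) F (enum 'I_(n * d)).

(* C^k(U) for U open; the values of F outside U are irrelevant. *)
Fixpoint Ck k U F : Prop :=
  (forall x, U x -> {for x, continuous F}) /\
  (if k is k'.+1 then
     forall l, (forall x, U x -> derivable F x (coord_dir l)) /\
               Ck k' U (partial l F)
   else True).

Definition Ck_extension k V p U F : Prop :=
  [/\ open U, V `<=` U, Ck k U F & forall x, V x -> F x = p x].

(* p|_V belongs to C^k(V). *)
Definition Ck_on k V p : Prop := exists U F, Ck_extension k V p U F.

(* sum over |a| <= k of max_V |D^a F| *)
Definition sum_max_deriv k V F : R :=
  \sum_(a : mpoly.bmultinom (n * d) k.+1)
    sup [set `|mderiv a F x| | x in V].

(* An element p of C^k(V) is only given on V, whereas sum_max_deriv evaluates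
   derivatives of an extension of p; the infimum over all C^k extensions makes
   the norm a function of p|_V alone. If V is contained in the closure of its
   interior, the derivatives on V do not depend on the extension and the
   infimum is the plain sum of maxima: see Ck_normE below. *)
Definition Ck_norm k V p : R :=
  inf [set s | exists U F, Ck_extension k V p U F /\ s = sum_max_deriv k V F].

Lemma eq_partial U F1 F2 l : open U -> (forall x, U x -> F1 x = F2 x) ->
  forall x, U x -> partial l F1 x = partial l F2 x.
Proof.
move=> oU e x Ux; apply: near_eq_derive.
by apply: filterS (open_nbhs_nbhs (conj oU Ux)) => y /e.
Qed.

Lemma eq_mderiv U F1 F2 a : open U -> (forall x, U x -> F1 x = F2 x) ->
  forall x, U x -> mderiv a F1 x = mderiv a F2 x.
Proof.
move=> oU e; rewrite /mderiv; elim: (enum _) => //= l s IHs.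
by elim: (a l) => //= j IHj; apply: eq_partial.
Qed.

Lemma Ck_iter_partial k j U F l : Ck (j + k) U F -> Ck k U (iter j (partial l) F).
Proof.
elim: j F => // j IHj F [_ /(_ l)[_ /IHj]].
by rewrite -iterSr.
Qed.

Lemma Ck_mderiv k U F (a : mpoly.bmultinom (n * d) k.+1) :
  Ck k U F -> forall x, U x -> {for x, continuous (mderiv a F)}.
Proof.
suff H s j G : Ck (\sum_(l <- s) a l + j) U G ->
    Ck j U (foldr (fun l => iter (a l) (partial l)) G s).
  move=> CF; suff : Ck (k - mpoly.mdeg a) U (mderiv a F).
    by case: (_ - _)%N => [|?] [].
  apply: H; rewrite big_enum /= -mpoly.mdegE subnKC //.
  by rewrite -ltnS mpoly.bmdeg.
elim: s j => [|l s IHs] j /=; first by rewrite big_nil.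
by rewrite big_cons addnAC addnC => C; apply/Ck_iter_partial/IHs.
Qed.

Lemma Ck_normE k V p U F : V `<=` closure V° -> Ck_extension k V p U F ->
  Ck_norm k V p = sum_max_deriv k V F.
Proof.
move=> regV eF; rewrite /Ck_norm -[RHS]inf1; congr inf.
apply/seteqP; split => [_ [U' [F' [eF' ->]]] | _ ->] /=; last by exists U, F.
apply: eq_bigr => a _; congr sup; apply: eq_imagel => x Vx; congr `|_|.
case: eF eF' => [_ VU CF eF] [_ VU' CF' eF'].
have eint y : V° y -> mderiv a F' y = mderiv a F y.
  apply: eq_mderiv; first exact: open_interior.
  by move=> z /interior_subset Vz; rewrite eF' ?eF.
apply/eqP; rewrite -subr_eq0; apply/negPn/negP => ne0.
have c : {for x, continuous (fun y => mderiv a F' y - mderiv a F y)}.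
  have c1 := Ck_mderiv (a:=a) CF' (VU' _ Vx); have c2 := Ck_mderiv (a:=a) CF (VU _ Vx).
  exact: cvgB c1 c2.
have nb : \forall y \near x, mderiv a F' y - mderiv a F y != 0.
  exact: cvgr_neq0 _ c ne0.
have [y [/eint e]] := regV _ Vx _ nb.
by rewrite /= e subrr eqxx.
Qed.

End Points.

(* Main.v *)
(* Write K for Omega^n and let F be a C^k extension of f to a neighbourhood of K.
   Multiplying F by a C^k cutoff function that is 1 on K gives a C^k extension
   to the whole space; since the norm is an infimum over extensions, it only has
   to agree with f on K itself.

   A global C^k function is approximated, with all its partial derivatives of
   order <= k, on a cube containing K by applying Bernstein operators in one
   coordinate after the other: the result is polynomial in every coordinate.
   The Bernstein operator B_N in the coordinate l commutes with the other
   partial derivatives, and d_l B_(N+1) F is, up to a factor close to 1,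
   B_N applied to a difference quotient of F. By the mean value theorem an
   iterated difference quotient is the iterated derivative at a nearby point, so
   the derivatives of B_N F converge like Bernstein operators applied to the
   continuous derivatives of F.

   Finally the polynomial Q is averaged over the finite image of G in the
   permutations of [n]. On K, f minus the average is the average of the
   functions (F - Q) o s because f is invariant, and the derivatives of
   (F - Q) o s along words of coordinates are those of F - Q along permuted
   words; hence all words, not only sorted ones, are estimated. *)

Require Import Defs.
From HB Require Import structures.
From mathcomp Require Import all_boot all_order all_algebra.
From mathcomp Require Import all_classical all_reals all_analysis.
From mathcomp Require mpoly.
From mathcomp Require Import (canonicals, coercions) mpoly.
From mathcomp Require Import ring lra.

Set Implicit Arguments.
Unset Strict Implicit.
Unset Printing Implicit Defensive.

Import Order.TTheory GRing.Theory Num.Theory.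
Import numFieldNormedType.Exports.

Local Open Scope classical_set_scope.
Local Open Scope ring_scope.

(** * C^k functions *)

Section Calculus.
Context {R : realType} {n d : nat}.
Notation pt := 'M[R]_(n, d).
Notation dir := (@coord_dir R n d).
Implicit Types (x v : pt) (F H : pt -> R) (U : set pt) (l m : 'I_(n * d)).

Definition coord l x : R := mxvec x 0 l.

Lemma coordD l m x (t : R) :
  coord l (x + t *: dir m) = coord l x + t * (l == m)%:R.
Proof. by rewrite /coord linearD linearZ /= vec_mxK !mxE eqxx. Qed.

Lemma continuous_coord l : continuous (coord l).
Proof.
case: (mxvec_indexP l) => i j.
rewrite (_ : coord _ = fun x => x i j); first exact: coord_continuous.
by apply/funext => x; rewrite /coord mxvecE.
Qed.

Lemma sum_coord x : x = \sum_l coord l x *: dir l.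
Proof.
apply: (can_inj mxvecK); rewrite linear_sum /=; apply/rowP => m.
rewrite summxE (bigD1 m) //= linearZ /= vec_mxK !mxE !eqxx mulr1.
rewrite big1 ?addr0 // => l lm.
by rewrite linearZ /= vec_mxK !mxE eq_sym (negPf lm) mulr0.
Qed.

(** The two difference quotients are the same function of the increment. This carries one-variable
    results, such as the mean value theorem and the chain rule, over to directional derivatives. *)
Lemma derivative_line F v x (t : R) (df : R) :
  is_derive (x + t *: v) v F df <-> is_derive t 1 (fun s => F (x + s *: v)) df.
Proof.
have e : (fun h : R => h^-1 *: ((F \o shift (x + t *: v)) (h *: v) -
      F (x + t *: v))) =
    (fun h : R => h^-1 *: (((fun s => F (x + s *: v)) \o shift t) (h *: 1) -
      F (x + t *: v))).
  apply/funext => h /=; congr (_ *: (F _ - _)).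
  by rewrite scalerDl addrCA [h%:A]mulr1.
split=> -[]; rewrite /derivable /derive.
  by rewrite e; constructor.
by rewrite -e; constructor.
Qed.

Lemma derivative_line0 F v x (df : R) :
  is_derive x v F df <-> is_derive (0 : R) 1 (fun s => F (x + s *: v)) df.
Proof. by rewrite -derivative_line scale0r addr0. Qed.

Lemma is_derive_coord l m x : is_derive x (dir m) (coord l) (l == m)%:R.
Proof.
apply/derivative_line0.
rewrite (_ : (fun s => _) = cst (coord l x) + (l == m)%:R \*: (@id R)); last first.
  by apply/funext => s; rewrite coordD [s * _]mulrC.
by apply: is_derive_eq; rewrite add0r [_%:A]mulr1.
Qed.

Lemma Ck_continuous k U F : Ck k U F -> forall x, U x -> {for x, continuous F}.
Proof. by case: k => [|k] []. Qed.

Lemma Ck_derivable k U F l : Ck k.+1 U F ->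
  forall x, U x -> is_derive x (dir l) F (partial l F x).
Proof. by move=> [_ /(_ l)[dF _]] x Ux; apply/derivableP/dF. Qed.

Lemma Ck_partial k U F l : Ck k.+1 U F -> Ck k U (partial l F).
Proof. by move=> [_ /(_ l)[]]. Qed.

Lemma continuous_eq_open U F1 F2 x : open U -> {in U, F1 =1 F2} -> U x ->
  {for x, continuous F1} -> {for x, continuous F2}.
Proof.
move=> oU e Ux cF1; rewrite /prop_for /continuous_at -e ?inE//.
have e' : \near x, F1 x = F2 x.
  by apply: filterS (open_nbhs_nbhs (conj oU Ux)) => y Uy; rewrite e ?inE.
exact: cvg_trans (near_eq_cvg e') cF1.
Qed.

Lemma Ck_eq k U F1 F2 : open U -> {in U, F1 =1 F2} -> Ck k U F1 -> Ck k U F2.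
Proof.
move=> oU; elim: k F1 F2 => [|k IH] F1 F2 e C1.
  by split => // x Ux; exact: (continuous_eq_open oU e Ux (Ck_continuous C1 Ux)).
split=> [x Ux|l]; first exact: (continuous_eq_open oU e Ux (Ck_continuous C1 Ux)).
have nr x : U x -> \near x, F1 x = F2 x.
  move=> Ux.
  by apply: filterS (open_nbhs_nbhs (conj oU Ux)) => y Uy; rewrite e ?inE.
split=> [x Ux|].
  by case: C1 => _ /(_ l)[/(_ x Ux) dF _]; apply: near_eq_derivable dF; apply: nr.
apply: IH (Ck_partial l C1) => x; rewrite inE => Ux.
by apply: near_eq_derive; apply: nr.
Qed.

(** Smoothness is shown by exhibiting the partial derivatives [df] on [U] only: since [U] is open,
    [Ck] does not see the values elsewhere. *)
Lemma CkSP k U F (df : 'I_(n * d) -> pt -> R) : open U ->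
  (forall x, U x -> {for x, continuous F}) ->
  (forall l x, U x -> is_derive x (dir l) F (df l x)) ->
  (forall l, Ck k U (df l)) -> Ck k.+1 U F.
Proof.
move=> oU cF dF cdF; split => // l; split => [x /(dF l)[]//|].
apply: Ck_eq (cdF l) => // x; rewrite inE => /(dF l) d1.
by rewrite /partial derive_val.
Qed.

Lemma Ck_pred k U F : Ck k.+1 U F -> Ck k U F.
Proof.
elim: k F => [|k IH] F [cF dF]; first by split.
by split => // l; have [dl Cl] := dF l; split => //; apply: IH.
Qed.

Lemma Ck_leq j k U F : (j <= k)%N -> Ck k U F -> Ck j U F.
Proof. by move=> /subnK <-; elim: (k - j)%N => // i IH /Ck_pred. Qed.

Lemma Ck_subset k U U' F : U `<=` U' -> Ck k U' F -> Ck k U F.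
Proof.
move=> UU'; elim: k F => [|k IH] F [cF dF]; first by split=> // x /UU'/cF.
split=> [x /UU'/cF//|l]; have [dl /IH Cl] := dF l.
by split => // x /UU'/dl.
Qed.

(** Each clause of [Ck] is a condition at one point, so it can be checked piecewise. This glues the
    two pieces of the cutoff extension. *)
Lemma Ck_setU k U U' F : Ck k U F -> Ck k U' F -> Ck k (U `|` U') F.
Proof.
elim: k F => [|k IH] F [cF dF] [cF' dF']; split => //.
- by move=> x [/cF|/cF'].
- by move=> x [/cF|/cF'].
move=> l; have [dl Cl] := dF l; have [dl' Cl'] := dF' l.
by split; [move=> x [/dl|/dl'] | exact: IH].
Qed.

Lemma Ck_cst k U (c : R) : open U -> Ck k U (cst c).
Proof.
move=> oU; elim: k c => [|k IH] c; first by split => // x _; exact: cst_continuous.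
by apply: (CkSP (df := fun _ => cst 0)) => // x _; exact: cst_continuous.
Qed.

Lemma Ck_coord k U l : open U -> Ck k U (coord l).
Proof.
move=> oU; case: k => [|k]; first by split => // x _; exact: continuous_coord.
apply: (CkSP (df := fun m => cst (l == m)%:R)) => // [x _|m x _|m].
- exact: continuous_coord.
- exact: is_derive_coord.
- exact: Ck_cst.
Qed.

Lemma CkD k U F H : open U -> Ck k U F -> Ck k U H -> Ck k U (F + H).
Proof.
move=> oU; elim: k F H => [|k IH] F H CF CH.
  split=> // x Ux; apply: continuousD; first exact: (Ck_continuous CF Ux).
  exact: (Ck_continuous CH Ux).
apply: (CkSP (df := fun l => partial l F + partial l H)) => // [x Ux|l x Ux|l].
- by apply: continuousD; [exact: (Ck_continuous CF Ux)|exact: (Ck_continuous CH Ux)].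
- by apply: is_deriveD; [exact: (Ck_derivable l CF Ux)|exact: (Ck_derivable l CH Ux)].
- by apply: IH; apply: Ck_partial.
Qed.

Lemma CkM k U F H : open U -> Ck k U F -> Ck k U H -> Ck k U (F * H).
Proof.
move=> oU; elim: k F H => [|k IH] F H CF CH.
  split=> // x Ux; apply: continuousM; first exact: (Ck_continuous CF Ux).
  exact: (Ck_continuous CH Ux).
apply: (CkSP (df := fun l => F * partial l H + H * partial l F)) => // [x Ux|l x Ux|l].
- by apply: continuousM; [exact: (Ck_continuous CF Ux)|exact: (Ck_continuous CH Ux)].
- by apply: is_deriveM; [exact: (Ck_derivable l CF Ux)|exact: (Ck_derivable l CH Ux)].
- by apply: CkD => //; apply: IH; try exact: Ck_partial; exact: Ck_pred.
Qed.

Lemma CkZ k U (c : R) F : open U -> Ck k U F -> Ck k U (c \*o F).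
Proof. by move=> oU CF; apply: (@CkM k U (cst c) F) => //; apply: Ck_cst. Qed.

Lemma CkB k U F H : open U -> Ck k U F -> Ck k U H -> Ck k U (F - H).
Proof.
move=> oU CF CH; have -> : F - H = F + (-1 \*o H).
  by apply/funext => x; rewrite -[RHS]/(F x + -1 * H x) mulN1r.
by apply: CkD => //; apply: CkZ.
Qed.

Lemma Ck_sum k U (I : Type) (r : seq I) (P : pred I) (F : I -> pt -> R) :
  open U -> (forall i, P i -> Ck k U (F i)) -> Ck k U (\sum_(i <- r | P i) F i).
Proof.
move=> oU CF; elim/big_rec : _ => [|i H Pi CH]; first exact: Ck_cst.
by apply: CkD => //; apply: CF.
Qed.

Section AffineChange.
(** [L] sends a coordinate line to a coordinate line ([b m] true) or to a point ([b m] false).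
    Translations, fixing one coordinate and permuting rows are of this kind. *)
Variables (L : pt -> pt) (b : pred 'I_(n * d)) (p : 'I_(n * d) -> 'I_(n * d)).
Hypothesis cL : continuous L.
Hypothesis LD : forall x t m, L (x + t *: dir m) = L x + (t * (b m)%:R) *: dir (p m).

Lemma is_derive_affine F m x df : is_derive (L x) (dir (p m)) F df ->
  is_derive x (dir m) (F \o L) ((b m)%:R * df).
Proof.
move=> /derivative_line0 dF; apply/derivative_line0 => /=.
case: (boolP (b m)) => bm.
  rewrite mul1r; rewrite (_ : (fun s => _) = (fun s => F (L x + s *: dir (p m)))) //.
  by apply/funext => s; rewrite LD bm mulr1.
rewrite mul0r (_ : (fun s => _) = cst (F (L x))); first exact: is_derive_cst.
by apply/funext => s; rewrite LD (negPf bm) mulr0 scale0r addr0.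
Qed.

Lemma partial_affine F m : 
  partial m (F \o L) = (b m)%:R \*o (partial (p m) F \o L).
Proof.
apply/funext => x; rewrite /partial /derive /=.
case: (boolP (b m)) => bm.
  rewrite mul1r.
  suff -> : (fun h => h^-1 *: (F (L (h *: dir m + x)) - F (L x))) =
      (fun h => h^-1 *: (F (h *: dir (p m) + L x) - F (L x))) by [].
  apply/funext => h; by rewrite [h *: _ + _]addrC LD bm mulr1 [h *: _ + _]addrC.
rewrite mul0r; apply: lim_near_cst => //=; near=> h.
by rewrite [h *: _ + _]addrC LD (negPf bm) mulr0 scale0r addr0 subrr scaler0.
Unshelve. all: by end_near. Qed.

Lemma Ck_affine k F : Ck k setT F -> Ck k setT (F \o L).
Proof.
elim: k F => [|k IH] F CF.
  by split => // x _; apply: continuous_comp; [exact: cL | exact: Ck_continuous CF _ _].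
apply: (CkSP (df := fun m => (b m)%:R \*o (partial (p m) F \o L))) => //.
- exact: openT.
- by move=> x _; apply: continuous_comp; [exact: cL | exact: Ck_continuous CF _ _].
- by move=> l x _; apply: is_derive_affine; exact: Ck_derivable CF _ _.
- by move=> l; apply: CkZ; [exact: openT | apply: IH; apply: Ck_partial].
Qed.

End AffineChange.

(** The head of the word is differentiated last. Words can be peeled letter by letter and relabelled
    by a permutation of the coordinates. *)
Definition partials (w : seq 'I_(n * d)) F := foldr (fun l => partial l) F w.

Lemma Ck_partials w j F : Ck (size w + j) setT F -> Ck j setT (partials w F).
Proof.
elim: w j => //= l w IH j C; apply: (@Ck_partial _ _ _ l).
by apply: IH; rewrite addnS -addSn.
Qed.

End Calculus.

(** * Mean values and symmetry of second derivatives *)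

Section MeanValue.
Context {R : realType} {n d : nat}.
Notation pt := 'M[R]_(n, d).
Notation dir := (@coord_dir R n d).
Implicit Types (x : pt) (F G : pt -> R) (l m : 'I_(n * d)).

Definition translate (v : pt) F : pt -> R := F \o (fun x => x + v).

Lemma Ck_translate k v F : Ck k setT F -> Ck k setT (translate v F).
Proof.
apply: (@Ck_affine _ _ _ (fun x => x + v) predT id).
  move=> x; exact: (@cvgD _ _ _ (nbhs x) _ id (cst v) x v cvg_id (cvg_cst v)).
by move=> x t m /=; rewrite mulr1 addrAC.
Qed.

Lemma partial_translate m v F :
  partial m (translate v F) = translate v (partial m F).
Proof.
rewrite (@partial_affine _ _ _ (fun x => x + v) predT id) /=.
  by apply/funext => x /=; rewrite mul1r.
by move=> x t l /=; rewrite mulr1 addrAC.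
Qed.

Lemma partialD m F G : Ck 1 setT F -> Ck 1 setT G ->
  partial m (F + G) = partial m F + partial m G.
Proof.
move=> CF CG; apply/funext => x.
by apply: deriveD; apply: ex_derive;
  [exact: (Ck_derivable m CF I) | exact: (Ck_derivable m CG I)].
Qed.

Lemma partialB m F G : Ck 1 setT F -> Ck 1 setT G ->
  partial m (F - G) = partial m F - partial m G.
Proof.
move=> CF CG; apply/funext => x.
by apply: deriveB; apply: ex_derive;
  [exact: (Ck_derivable m CF I) | exact: (Ck_derivable m CG I)].
Qed.

Lemma partialZ m (c : R) F : Ck 1 setT F ->
  partial m (c \*o F) = c \*o partial m F.
Proof.
move=> CF; apply/funext => x.
by apply: deriveMl; apply: ex_derive; exact: (Ck_derivable m CF I).
Qed.

Lemma mean_value l F x (h : R) : Ck 1 setT F -> 0 <= h ->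
  exists2 c : R, 0 <= c <= h &
    F (x + h *: dir l) - F x = h * partial l F (x + c *: dir l).
Proof.
move=> CF h0.
have dF t : is_derive t (1 : R) (fun s => F (x + s *: dir l))
    (partial l F (x + t *: dir l)).
  by apply/derivative_line; exact: (Ck_derivable l CF I).
have [|c c0h] := MVT_segment h0 (fun t _ => dF t).
  apply: derivable_within_continuous => t _; exact: ex_derive.
rewrite scale0r addr0 subr0 mulrC => ->.
by exists c => //; move: c0h; rewrite in_itv.
Qed.

(** The mean value theorem is applied twice: in direction [l] to the increment of [F] in direction
    [m], then in direction [m] to [partial l F]. *)
Lemma second_difference l m F x (h : R) : Ck 2 setT F -> 0 <= h ->
  exists c : R * R, [/\ 0 <= c.1 <= h, 0 <= c.2 <= h &
    F (x + h *: dir l + h *: dir m) - F (x + h *: dir l)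
      - (F (x + h *: dir m) - F x) =
    h * h * partial m (partial l F) (x + c.1 *: dir l + c.2 *: dir m)].
Proof.
move=> CF h0; have CF1 := Ck_pred CF.
have C1 : Ck 1 setT (translate (h *: dir m) F - F).
  by apply: CkB; [exact: openT | exact: Ck_translate |].
have [c c0h e1] := mean_value l x C1 h0.
have [c' c'0h e2] := mean_value m (x + c *: dir l) (Ck_partial l CF) h0.
exists (c, c'); split=> //=.
rewrite -mulrA -e2.
have {}e1 : F (x + h *: dir l + h *: dir m) - F (x + h *: dir l)
      - (F (x + h *: dir m) - F x) =
   h * partial l (translate (h *: dir m) F - F) (x + c *: dir l) by exact: e1.
by rewrite e1 (partialB l (Ck_translate _ CF1) CF1) partial_translate.
Qed.

(** The second difference over a square of side [h] is symmetric in [l] and [m], so the two mixed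
    derivatives agree at two points close to [x]; their continuity at [x] then bounds the gap by any
    [e]. *)
Lemma partialC l m F : Ck 2 setT F ->
  partial l (partial m F) = partial m (partial l F).
Proof.
move=> CF; apply/funext => x; apply/eqP; rewrite -subr_eq0 -normr_le0.
apply/ler_addgt0Pr => e e0; rewrite add0r.
have near_line l1 l2 (H : pt -> R) : {for x, continuous H} ->
    exists2 r : R, 0 < r & forall s t : R, 0 <= s <= r -> 0 <= t <= r ->
      `|H (x + s *: dir l1 + t *: dir l2) - H x| < e / 2.
  move=> cH; have e20 : 0 < e / 2 by rewrite divr_gt0.
  have /nbhs_ballP[r /= r0 rP] : nbhs x [set y | `|H x - H y| < e / 2].
    by move: cH => /cvgr_dist_lt/(_ _ e20).
  have D0 : 0 < `|dir l1| + `|dir l2| + 1 :> R.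
    by rewrite ltr_wpDl // addr_ge0.
  (* This keeps the total displacement at norm at most [r / 2]; the added 1 makes the denominator
     positive. *)
  exists (r / 2 / (`|dir l1| + `|dir l2| + 1)); first by rewrite !divr_gt0.
  move=> s t /andP[s0 sr] /andP[t0 tr]; rewrite distrC; apply: rP => /=.
  rewrite -ball_normE /= -addrA opprD addNKr normrN.
  apply: le_lt_trans (ler_normD _ _) _; rewrite !normrZ !ger0_norm //.
  apply: (@le_lt_trans _ _ (r / 2 / (`|dir l1| + `|dir l2| + 1) *
      (`|dir l1| + `|dir l2|))).
    by rewrite mulrDr lerD // ler_wpM2r.
  apply: (@le_lt_trans _ _ (r / 2)).
    rewrite -mulrA ger_pMr ?divr_gt0// mulrC ler_pdivrMr // mul1r.
    by rewrite lerDl.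
  by rewrite ltr_pdivrMr // ltr_pMr // ltr1n.
have [r1 r10 H1] := near_line m l _
  (Ck_continuous (Ck_partial l (Ck_partial m CF)) (I : setT x)).
have [r2 r20 H2] := near_line l m _
  (Ck_continuous (Ck_partial m (Ck_partial l CF)) (I : setT x)).
pose h := Num.min r1 r2; have h0 : 0 < h by rewrite lt_min r10.
have [c [c1 c2 ec]] := second_difference m l x CF (ltW h0).
have [c' [c1' c2' ec']] := second_difference l m x CF (ltW h0).
have ee : partial l (partial m F) (x + c.1 *: dir m + c.2 *: dir l) =
   partial m (partial l F) (x + c'.1 *: dir l + c'.2 *: dir m).
  apply: (@mulfI _ (h * h)); first by rewrite mulf_neq0 // gt_eqF.
  apply: (etrans (esym ec)); apply: (etrans _ ec').
  rewrite (addrAC x (h *: dir m) (h *: dir l)).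
  move: (F (x + _ + _)) (F (x + _ *: dir l)) (F (x + _)) (F x) => a1 a2 a3 a4.
  by ring.
clear ec ec'.
have hr1 : h <= r1 by rewrite /h ge_min lexx.
have hr2 : h <= r2 by rewrite /h ge_min lexx orbT.
have le_ (a r : R) : h <= r -> 0 <= a <= h -> 0 <= a <= r.
  by move=> hr /andP[-> /le_trans->].
have A := H1 _ _ (le_ _ _ hr1 c1) (le_ _ _ hr1 c2).
have B := H2 _ _ (le_ _ _ hr2 c1') (le_ _ _ hr2 c2').
move: A B; rewrite ee.
move: (partial m _ (x + _ + _)) (partial l _ x) (partial m _ x) => a b b'.
rewrite distrC => A B; apply: le_trans (ler_distD a _ _) _.
by rewrite [leRHS]splitr; apply: ltW; apply: ltrD.
Qed.

Lemma partial_iterC l m j F : Ck j.+1 setT F ->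
  partial m (iter j (partial l) F) = iter j (partial l) (partial m F).
Proof.
elim: j F => // j IH F CF; rewrite !iterSr partialC; last exact: Ck_leq CF.
by rewrite IH //; exact: Ck_partial CF.
Qed.

(** By symmetry of second derivatives all letters [l] move to the front, where they match an
    iterated difference quotient in direction [l]. *)
Lemma partials_count l w F : Ck (size w) setT F ->
  partials w F =
  iter (count_mem l w) (partial l) (partials [seq m <- w | m != l] F).
Proof.
elim: w => //= m w IH CF; rewrite IH; last exact: Ck_pred.
case: eqVneq => [->|ml] //=; rewrite partial_iterC //.
have := CF; rewrite -(count_predC (pred1 l)) -size_filter addnC => CF'.
apply: Ck_partials; rewrite addnS; move: CF.
by rewrite -(count_predC (pred1 l) w) addnC size_filter.
Qed.

Definition diff_quot l (h : R) F : pt -> R :=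
  h^-1 \*o (translate (h *: dir l) F - F).

Lemma Ck_diff_quot k l h F : Ck k setT F -> Ck k setT (diff_quot l h F).
Proof.
move=> CF; apply/CkZ; first exact: openT.
by apply: CkB; [exact: openT | exact: Ck_translate |].
Qed.

Lemma Ck_iter_diff_quot k j l h F :
  Ck k setT F -> Ck k setT (iter j (diff_quot l h) F).
Proof. by move=> CF; elim: j => //= j; exact: Ck_diff_quot. Qed.

Lemma partial_diff_quot l m h F : Ck 1 setT F ->
  partial m (diff_quot l h F) = diff_quot l h (partial m F).
Proof.
move=> CF; have CT := Ck_translate (h *: dir l) CF.
rewrite partialZ; last first.
  by apply: CkB; [exact: openT | by [] |].
by rewrite (partialB m CT CF) partial_translate.
Qed.

Lemma partial_iter_diff_quot l m j h F : Ck 1 setT F ->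
  partial m (iter j (diff_quot l h) F) = iter j (diff_quot l h) (partial m F).
Proof.
move=> CF; elim: j => //= j IH.
by rewrite (partial_diff_quot l m h (Ck_iter_diff_quot j l h CF)) IH.
Qed.

(** The mean value theorem turns the outermost quotient into a derivative at a point shifted by at
    most [h]; this derivative moves inside the other quotients, and the shifts add up. *)
Lemma iter_diff_quotE l j (h : R) F x : 0 < h -> Ck j setT F ->
  exists2 c : R, 0 <= c <= j%:R * h &
    iter j (diff_quot l h) F x = iter j (partial l) F (x + c *: dir l).
Proof.
move=> h0; elim: j F x => [|j IH] F x CF.
  by exists 0; rewrite ?mul0r ?lexx ?scale0r ?addr0.
have CF1 : Ck 1 setT F by exact: Ck_leq CF.
have CD := Ck_iter_diff_quot j l h CF1.
have [c /andP[c0 ch] e] := mean_value l x CD (ltW h0).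
have [c' /andP[c'0 c'h] e'] := IH _ (x + c *: dir l) (Ck_partial l CF).
exists (c + c').
  by rewrite addr_ge0 //= -natr1 mulrDl mul1r addrC lerD.
rewrite iterS iterSr scalerDl addrA -e' -partial_iter_diff_quot //.
rewrite -[LHS]/(h^-1 * (iter j (diff_quot l h) F (x + h *: dir l) -
  iter j (diff_quot l h) F x)) e mulrA mulVf ?mul1r //.
by rewrite gt_eqF.
Qed.

End MeanValue.

(** * Bernstein operators in one coordinate *)

Section Bernstein.
Context {R : realType}.
Implicit Types (phi psi : nat -> R) (t : R).

(* De Casteljau's recursion: [bern N phi t] is the sum over [j <= N] of
   [phi j * 'C(N, j) * t ^+ j * (1 - t) ^+ (N - j)]. *)
Fixpoint bern (N : nat) phi t : R :=
  if N is N'.+1 then (1 - t) * bern N' phi t + t * bern N' (phi \o S) t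
  else phi 0%N.

Lemma bernD N phi psi t : bern N (phi + psi) t = bern N phi t + bern N psi t.
Proof.
elim: N phi psi => //= N IH phi psi.
by rewrite IH -[(phi + psi) \o S]/((phi \o S) + (psi \o S)) IH; ring.
Qed.

Lemma bernZ N (c : R) phi t : bern N (c \*o phi) t = c * bern N phi t.
Proof.
elim: N phi => //= N IH phi.
by rewrite IH -[(c \*o phi) \o S]/(c \*o (phi \o S)) IH; ring.
Qed.

Lemma bern_cst N (c : R) t : bern N (cst c) t = c.
Proof. by elim: N => //= N IH; rewrite -[cst c \o S]/(cst c) IH; ring. Qed.

(** Second moment of the binomial distribution about [y]: variance plus squared bias. The induction
    is over all [y], since shifting [phi] replaces [y] by [y - 1]. *)
Lemma bern_sqr N (y : R) t :
  bern N (fun j => (j%:R - y) ^+ 2) t = N%:R * (t * (1 - t)) + (N%:R * t - y) ^+ 2.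
Proof.
elim: N y => [|N IH] y /=; first by rewrite mulr0n; ring.
rewrite IH [X in bern N X](_ : _ = (fun j => (j%:R - (y - 1)) ^+ 2)).
  by rewrite IH -natr1; ring.
by apply/funext => j /=; rewrite -natr1; congr (_ ^+ 2); ring.
Qed.

Lemma ler_bern N phi psi t : 0 <= t <= 1 ->
  (forall j, (j <= N)%N -> phi j <= psi j) -> bern N phi t <= bern N psi t.
Proof.
move=> /andP[t0 t1]; elim: N phi psi => [|N IH] phi psi le_ /=; first exact: le_.
apply: lerD; apply: ler_wpM2l; rewrite ?subr_ge0 //; apply: IH => j jN.
  by apply: le_; apply: leqW.
by apply: le_.
Qed.

(** A Chebyshev-type bound: the operator is monotone on [0, 1], and the image of the quadratic
    majorant [psi] involves only the variance, which is at most [N]. *)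
Lemma bern_estimate N phi t (v e C : R) : 0 <= t <= 1 -> 0 <= C ->
  (forall j, (j <= N)%N -> `|phi j - v| <= e + C * (j%:R - N%:R * t) ^+ 2) ->
  `|bern N phi t - v| <= e + C * N%:R.
Proof.
move=> t01 C0 le_.
pose psi : nat -> R := cst e + C \*o (fun j => (j%:R - N%:R * t) ^+ 2).
have bpsi : bern N psi t <= e + C * N%:R.
  rewrite bernD bernZ bern_cst bern_sqr subrr expr0n addr0 lerD2l ler_wpM2l //.
  case/andP: t01 => t0 t1; rewrite -[leRHS]mulr1 ler_wpM2l // mulr_ile1 ?subr_ge0 //.
  by rewrite gerBl.
rewrite ler_norml; apply/andP; split.
  have : bern N (cst v + -1 \*o psi) t <= bern N phi t.
    apply: ler_bern => // j jN; rewrite -[leLHS]/(v + -1 * psi j).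
    have := le_ j jN; rewrite -/(psi j) ler_norml => /andP[+ _].
    rewrite [in X in X -> _](_ : e + _ = psi j) //.
    by move: (psi j) => p; lra.
  by rewrite bernD bernZ bern_cst; lra.
have : bern N phi t <= bern N (cst v + psi) t.
  apply: ler_bern => // j jN; rewrite -[leRHS]/(v + psi j).
  have := le_ j jN; rewrite ler_norml => /andP[_].
  rewrite [in X in X -> _](_ : e + _ = psi j) //.
  by move: (psi j) => p; lra.
by rewrite bernD bern_cst; lra.
Qed.

End Bernstein.

Section BernsteinOperator.
Context {R : realType} {n d : nat}.
Notation pt := 'M[R]_(n, d).
Notation dir := (@coord_dir R n d).
Implicit Types (x : pt) (F G : pt -> R) (l m : 'I_(n * d)).

Definition reset l (s : R) x : pt := x + (s - coord l x) *: dir l.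

Lemma coord_reset l m (s : R) x :
  coord m (reset l s x) = if m == l then s else coord m x.
Proof.
rewrite coordD; case: eqVneq => [->|_]; first by rewrite mulr1 addrC subrK.
by rewrite mulr0 addr0.
Qed.

Lemma reset_line l (s t : R) x : reset l s x + t *: dir l = reset l (s + t) x.
Proof. by rewrite /reset -addrA -scalerDl addrAC. Qed.

Lemma resetD l (s : R) x (t : R) m :
  reset l s (x + t *: dir m) = reset l s x + (t * (m != l)%:R) *: dir m.
Proof.
rewrite /reset coordD eq_sym; case: eqVneq => [->|_] /=.
  by rewrite mulr1 mulr0 scale0r addr0 -addrA -scalerDl; congr (_ + _ *: _); ring.
by rewrite mulr0 mulr1 addr0 addrAC.
Qed.

Lemma continuous_reset l (s : R) : continuous (reset l s).
Proof.
move=> x; apply: (@cvgD _ _ _ (nbhs x) _ id _ x _ cvg_id).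
apply: cvgZr_tmp; apply: (@cvgB _ _ _ (nbhs x) _ (cst s) (coord l) s).
  exact: cvg_cst.
exact: continuous_coord.
Qed.

Lemma Ck_reset k l (s : R) F : Ck k setT F -> Ck k setT (F \o reset l s).
Proof.
apply: (@Ck_affine _ _ _ (reset l s) (fun m => m != l) id).
  exact: continuous_reset.
exact: resetD.
Qed.

Lemma partial_reset l m (s : R) F :
  partial m (F \o reset l s) = (m != l)%:R \*o (partial m F \o reset l s).
Proof. exact: (@partial_affine _ _ _ (reset l s) (fun m => m != l) id (resetD l s)). Qed.

Lemma derive_blend (u A B : pt -> R) x v (du dA dB : R) :
  is_derive x v u du -> is_derive x v A dA -> is_derive x v B dB ->
  'D_v ((cst 1 - u) * A + u * B) x =
  (1 - u x) * dA + u x * dB + du * (B x - A x).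
Proof.
move=> du' dA' dB'.
have dA1 := is_deriveM (is_deriveB (is_derive_cst (1 : R) x v) du') dA'.
have [_ ->] := is_deriveD dA1 (is_deriveM du' dB').
rewrite -[(cst 1 - u) x]/(1 - u x) -![_ *: _]/(_ * _).
by move: (u x) (A x) (B x) => ? ? ?; ring.
Qed.

Variables (a rho : R).

(** For positive [rho] this runs over [0, 1] as the coordinate runs over [a, a + rho]. *)
Definition unit_coord l : pt -> R := rho^-1 \*o (coord l - cst a).

(* Bernstein operator in the coordinate [l] with the nodes [a + j * h]: the mesh
   [h] is independent of [N] because a derivative lowers [N] but not [h]. *)
Fixpoint bernop (h : R) l (N : nat) F : pt -> R :=
  if N is N'.+1 then
    (cst 1 - unit_coord l) * bernop h l N' F
      + unit_coord l * bernop h l N' (translate (h *: dir l) F)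
  else F \o reset l a.

Lemma bernopE h l N F x : bernop h l N F x =
  bern N (fun j => F (reset l (a + j%:R * h) x)) (unit_coord l x).
Proof.
elim: N F => [|N IH] F /=; first by rewrite mul0r addr0.
rewrite -[LHS]/((1 - unit_coord l x) * bernop h l N F x +
  unit_coord l x * bernop h l N (translate (h *: dir l) F) x) !IH.
congr (_ + _ * bern N _ _); apply/funext => j.
by rewrite /translate /= reset_line -natr1 mulrDl mul1r addrA.
Qed.

Lemma bernopB h l N F G : bernop h l N (F - G) = bernop h l N F - bernop h l N G.
Proof.
apply/funext => x; rewrite -[RHS]/(bernop h l N F x - bernop h l N G x) !bernopE.
rewrite -[X in _ = _ - X]mul1r -mulNr -bernZ -bernD.
congr (bern N _ _); apply/funext => j.
by rewrite -[RHS]/(_ + -1 * _) mulN1r.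
Qed.

Lemma bernopZ h l N (c : R) F : bernop h l N (c \*o F) = c \*o bernop h l N F.
Proof.
apply/funext => x; rewrite -[RHS]/(c * bernop h l N F x) !bernopE -bernZ.
by congr (bern N _ _); apply/funext.
Qed.

Lemma is_derive_unit_coord l m x :
  is_derive x (dir m) (unit_coord l) (rho^-1 * (l == m)%:R).
Proof.
have -> : unit_coord l = cst rho^-1 * (coord l - cst a) by [].
have dc := is_derive_coord l m x.
by apply: is_derive_eq; rewrite subr0 scaler0 addr0.
Qed.

Lemma Ck_unit_coord k l : Ck k setT (unit_coord l).
Proof.
apply: CkZ; first exact: openT.
by apply: CkB; [exact: openT | exact/Ck_coord/openT | exact/Ck_cst/openT].
Qed.

Lemma Ck_bernop k h l N F : Ck k setT F -> Ck k setT (bernop h l N F).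
Proof.
elim: N F => [|N IH] F CF /=; first exact: Ck_reset.
have oT := @openT pt; have Cu := Ck_unit_coord k l.
apply: CkD => //; apply: CkM => //; last exact/IH/Ck_translate.
- by apply: CkB => //; apply: Ck_cst.
- exact: IH.
Qed.

Lemma partial_bernopS h l m N F x : Ck 1 setT F ->
  partial m (bernop h l N.+1 F) x =
  (1 - unit_coord l x) * partial m (bernop h l N F) x
    + unit_coord l x * partial m (bernop h l N (translate (h *: dir l) F)) x
    + rho^-1 * (l == m)%:R *
      (bernop h l N (translate (h *: dir l) F) x - bernop h l N F x).
Proof.
move=> CF.
have dA := Ck_derivable m (Ck_bernop h l N CF) (I : setT x).
have dB := Ck_derivable m (Ck_bernop h l N (Ck_translate (h *: dir l) CF)) (I : setT x).
have du := is_derive_unit_coord l m x.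
exact: derive_blend.
Qed.

Lemma partial_bernop h l m N F : m != l -> Ck 1 setT F ->
  partial m (bernop h l N F) = bernop h l N (partial m F).
Proof.
move=> ml; elim: N F => [|N IH] F CF; apply/funext => x.
  by rewrite [LHS](congr1 (@^~ x) (partial_reset l m a F)) ml /= mul1r.
rewrite partial_bernopS // eq_sym (negPf ml) mulr0 mul0r addr0.
by rewrite (IH _ CF) (IH _ (Ck_translate _ CF)) partial_translate.
Qed.

(** The classical derivative formula for Bernstein polynomials. In the induction, the product rule
    gives [N.+1] copies from the two lower operators and one more from differentiating the
    weights. *)
Lemma partial_bernop_same h l N F : Ck 1 setT F ->
  partial l (bernop h l N.+1 F) =
  (N.+1%:R / rho) \*o bernop h l N (translate (h *: dir l) F - F).
Proof.
elim: N F => [|N IH] F CF; apply/funext => x; rewrite partial_bernopS // eqxx.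
  have e H : partial l (bernop h l 0 H) x = 0.
    by rewrite [LHS](congr1 (@^~ x) (partial_reset l l a H)) eqxx /= mul0r.
  by rewrite !e !mulr0 !add0r mulr1 -[RHS]/(_ * _) bernopB mul1r.
have CT := Ck_translate (h *: dir l) CF.
rewrite (congr1 (@^~ x) (IH _ CF)) (congr1 (@^~ x) (IH _ CT)).
set D := translate (h *: dir l) F - F.
have -> : translate (h *: dir l) (translate (h *: dir l) F) -
  translate (h *: dir l) F = translate (h *: dir l) D by [].
rewrite -![((_ \*o _) x)]/(_ * _).
have eN G : bernop h l N.+1 G x = (1 - unit_coord l x) * bernop h l N G x +
  unit_coord l x * bernop h l N (translate (h *: dir l) G) x by [].
have eD : bernop h l N.+1 (translate (h *: dir l) F) x - bernop h l N.+1 F x =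
   (1 - unit_coord l x) * bernop h l N D x +
   unit_coord l x * bernop h l N (translate (h *: dir l) D) x.
  by rewrite -eN bernopB.
rewrite eD (eN D) -[N.+2%:R]natr1 mulr1.
move: (unit_coord l x) (bernop h l N _ x) (bernop h l N D x) => u A B.
by ring.
Qed.

End BernsteinOperator.

(** * C^k approximation in one coordinate *)

Section BernsteinApproximation.
Context {R : realType} {n d : nat}.
Notation pt := 'M[R]_(n, d).
Notation dir := (@coord_dir R n d).
Implicit Types (x : pt) (F G : pt -> R) (l m : 'I_(n * d)) (w : seq 'I_(n * d)).

Definition cube (a rho : R) : set pt :=
  [set x | forall l, a <= coord l x <= a + rho].

Lemma continuous_vec_mx : continuous (@vec_mx R n d).
Proof.
move=> v U /nbhs_ballP[e e0 eU]; apply/nbhs_ballP; exists e => // u [_ vu].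
by apply: eU; split=> // i j; rewrite !mxE; apply: vu.
Qed.

Lemma compact_cube (a rho : R) : compact (cube a rho).
Proof.
have -> : cube a rho =
    @vec_mx R n d @` [set v : 'rV[R]_(n * d) |
      forall i, `[a, a + rho]%classic (v ord0 i)].
  apply/seteqP; split => [x xc|_ [v vc <-] l].
    exists (mxvec x); last exact: mxvecK.
    by move=> i /=; rewrite in_itv; exact: xc.
  by have := vc l; rewrite /= in_itv /coord vec_mxK.
apply: continuous_compact.
  by apply: continuous_subspaceT => v; exact: continuous_vec_mx.
apply: (@rV_compact _ _ (fun=> `[a, a + rho]%classic)) => _.
exact: segment_compact.
Qed.

(** Uniformity in [x] comes from the near-covering form of compactness, with the scale [eta] tending
    to 0 from the right as parameter. *)
Lemma uniformly_continuous_line G l (K : set pt) (e : R) :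
  compact K -> continuous G -> 0 < e ->
  exists2 eta : R, 0 < eta &
    forall x t, K x -> `|t| < eta -> `|G (x + t *: dir l) - G x| <= e.
Proof.
move=> /compact_near_coveringP cK cG e0.
have e20 : 0 < e / 2 by rewrite divr_gt0.
have D0 : 0 < `|dir l| + 1 :> R by rewrite ltr_wpDl.
pose P (eta : R) x := forall t, `|t| < eta -> `|G (x + t *: dir l) - G x| <= e.
have nP : \forall eta \near (0 : R)^'+, K `<=` P eta.
  apply: cK => x Kx.
  have /nbhs_ballP[r /= r0 rP] : nbhs x [set y | `|G x - G y| < e / 2].
    by have /cvgr_dist_lt/(_ _ e20) := cG x.
  exists (ball x (r / 2), [set eta | eta < r / 2 / (`|dir l| + 1)]).
    split; first by apply: nbhsx_ballx; rewrite divr_gt0.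
    by apply: nbhs_right_lt; rewrite !divr_gt0.
  move=> [y eta] [/= xy etar] t teta.
  have y1 : `|G x - G y| < e / 2.
    by apply: rP; apply: le_ball xy; rewrite ler_pdivrMr // ler_pMr // ler1n.
  have y2 : `|G x - G (y + t *: dir l)| < e / 2.
    apply: rP; rewrite [r]splitr; apply: ball_triangle xy _.
    rewrite -ball_normE /= opprD addNKr normrN normrZ.
    have tr := lt_trans teta etar.
    apply: (@le_lt_trans _ _ (r / 2 / (`|dir l| + 1) * `|dir l|)).
      by rewrite ler_wpM2r // ltW.
    by rewrite mulrAC ltr_pdivrMr // ltr_pM2l ?divr_gt0 // ltrDl.
  apply: le_trans (ler_distD (G x) _ _) _.
  by rewrite distrC [leRHS]splitr; apply/ltW/ltrD.
have nn : \forall eta \near (0 : R)^'+, 0 < eta by exact: nbhs_right_gt.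
have [eta [eta0 H]] := filter_ex (filterI nn nP).
by exists eta => // x t /H; apply.
Qed.

Lemma bounded_on_compact G (K : set pt) : compact K -> continuous G ->
  exists2 M : R, 0 <= M & forall x, K x -> `|G x| <= M.
Proof.
move=> cK cG; have [K0|] := pselect (K !=set0); last first.
  by move=> K0; exists 0 => // x Kx; case: K0; exists x.
have cN : {within K, continuous (fun x => `|G x|)}.
  apply: continuous_subspaceT => x.
  by apply: continuous_comp (cG x) _; exact: norm_continuous.
have [c cK' cM] := compact_EVT_max K0 cK cN.
by exists `|G c| => // x Kx; apply: cM; rewrite inE.
Qed.

(** There are finitely many words of length at most [k]; the induction splits off the first letter,
    which ranges over a finite type. *)
Lemma near_words (P : nat -> seq 'I_(n * d) -> Prop) k :
  (forall w, (size w <= k)%N -> \forall N \near \oo, P N w) ->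
  \forall N \near \oo, forall w, (size w <= k)%N -> P N w.
Proof.
elim: k P => [|k IH] P HP.
  by apply: filterS (HP [::] isT) => N PN w; rewrite leqn0 => /nilP ->.
have H l : \forall N \near \oo, forall w, (size w <= k)%N -> P N (l :: w).
  by apply: (IH (fun N w => P N (l :: w))) => w sw; exact: HP.
have H' : \forall N \near \oo, forall l w, (size w <= k)%N -> P N (l :: w).
  exact: filter_forall.
apply: filterS (filterI (HP [::] isT) H') => N [P0 PS] [|l w] //=.
by rewrite ltnS; apply: PS.
Qed.

(** The product N(N-1)...(N-r+1)/N^r is the factor left by [r] derivatives of an operator of degree
    [N]; the last bound shows that it tends to 1. *)
Lemma prod_falling_bounds (N r : nat) : (r <= N)%N -> (0 < N)%N ->
  let c := \prod_(i < r) (1 - i%:R / N%:R) : R in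
  [/\ 0 <= c, c <= 1 & 1 - c <= (r * r)%:R / N%:R].
Proof.
move=> + N0; have NR : 0 < N%:R :> R by rewrite ltr0n.
elim: r => [|r IH] rN /=; first by rewrite big_ord0 subrr mul0n mul0r.
have [c0 c1 cN] := IH (ltnW rN); rewrite big_ord_recr /=.
move: (\prod_(i < r) _) c0 c1 cN => c c0 c1 cN.
have q0 : 0 <= r%:R / N%:R :> R by rewrite divr_ge0 // ler0n.
have q1 : r%:R / N%:R <= 1 :> R.
  by rewrite ler_pdivrMr // mul1r ler_nat ltnW.
have qc : c * (r%:R / N%:R) <= r%:R / N%:R by rewrite ler_piMl.
split.
- by rewrite mulr_ge0 // subr_ge0.
- by rewrite mulr_ile1 // ?subr_ge0 // gerBl.
have -> : (r.+1 * r.+1)%:R = (r * r)%:R + r%:R + (r%:R + 1) :> R.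
  by rewrite !natrM -natr1; ring.
rewrite mulrBr mulr1 !mulrDl.
have : 0 <= (r%:R / N%:R + 1 / N%:R) :> R.
  by rewrite addr_ge0 // divr_ge0 // ltW.
lra.
Qed.

Variables (a rho : R).
Hypothesis rho0 : 0 < rho.

(** Letters other than [l] commute with the operator. The letter [l] met after [r] earlier ones
    lowers the degree from [N - r], producing a difference quotient and the factor (N-r)/rho times
    the mesh, which is 1 - r/N. *)
Lemma partials_bernop l N w F : Ck (size w) setT F ->
  (0 < N)%N -> (count_mem l w <= N)%N ->
  partials w (bernop a rho (rho / N%:R) l N F) =
  (\prod_(i < count_mem l w) (1 - i%:R / N%:R)) \*o
  bernop a rho (rho / N%:R) l (N - count_mem l w)
    (iter (count_mem l w) (diff_quot l (rho / N%:R))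
      (partials [seq m <- w | m != l] F)).
Proof.
move=> + N0; have NR : N%:R != 0 :> R by rewrite pnatr_eq0 -lt0n.
set h := rho / N%:R.
have h0 : h != 0 by rewrite mulf_neq0 ?invr_eq0 // gt_eqF.
elim: w => [|m w IH] CF; rewrite /= => cN.
  by rewrite big_ord0 subn0; apply/funext => x; rewrite /= mul1r.
set r := count_mem l w in IH cN *.
have rN : (r <= N)%N by apply: leq_trans cN; exact: leq_addl.
rewrite (IH (Ck_pred CF) rN).
set G := partials [seq m <- w | m != l] F in IH *.
have CG : Ck 1 setT G.
  apply: Ck_partials; apply: Ck_leq CF; rewrite addn1 ltnS.
  by rewrite size_filter count_size.
have CA := Ck_iter_diff_quot r l h CG.
rewrite partialZ; last exact: Ck_bernop.
case: eqVneq cN => [->|ml] /= cN; last first.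
  rewrite add0n (partial_bernop _ _ _ _ ml CA).
  by rewrite (partial_iter_diff_quot l m r h CG).
rewrite add1n in cN *.
have -> : (N - r)%N = (N - r.+1).+1 by rewrite subnSK.
rewrite (partial_bernop_same _ _ _ _ _ CA).
have -> : translate (h *: dir l) (iter r (diff_quot l h) G) -
    iter r (diff_quot l h) G = h \*o iter r.+1 (diff_quot l h) G.
  by apply/funext => x; rewrite /= mulrA divff // mul1r.
rewrite bernopZ big_ord_recr /=; apply/funext => x.
rewrite -[LHS]/(_ * (_ * (h * _))) -[RHS]/(_ * _) !mulrA; congr (_ * _).
rewrite -!mulrA; congr (_ * _).
rewrite subnSK // natrB // /h; field.
by rewrite NR gt_eqF.
Qed.

(** In units of the mesh, the distance is [j - N' t] plus an error [q - r t], where [q] and [r t]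
    both lie in [0, r]; then (y + p)^2 is at most 2y^2 + 2p^2. *)
Lemma node_bound (N N' r j : nat) (t c : R) : (0 < N)%N -> N = (N' + r)%N ->
  0 <= t <= 1 -> 0 <= c <= r%:R * (rho / N%:R) ->
  (j%:R * (rho / N%:R) + c - rho * t) ^+ 2 <=
  (rho / N%:R) ^+ 2 * (2 * (j%:R - N'%:R * t) ^+ 2 + 2 * (r * r)%:R).
Proof.
move=> N0 eN /andP[t0 t1] /andP[c0 cr].
have NR : 0 < N%:R :> R by rewrite ltr0n.
have hN : rho = rho / N%:R * N%:R by rewrite divfK // gt_eqF.
set h := rho / N%:R in cr hN *; have h0 : 0 < h by rewrite divr_gt0.
pose q := c / h.
have eq : c = h * q by rewrite mulrC divfK // gt_eqF.
have q0 : 0 <= q by rewrite divr_ge0 // ltW.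
have qr : q <= r%:R by rewrite ler_pdivrMr.
rewrite hN eq eN natrD natrM.
have -> : j%:R * h + h * q - h * (N'%:R + r%:R) * t =
   h * ((j%:R - N'%:R * t) + (q - r%:R * t)) by ring.
rewrite exprMn ler_wpM2l ?sqr_ge0 //.
have r0 : 0 <= r%:R :> R by [].
have rt0 : 0 <= r%:R * t by rewrite mulr_ge0.
have rtr : r%:R * t <= r%:R by rewrite ler_piMr.
move: (j%:R - _) => y.
move: (r%:R * t) rt0 rtr => z z0 zr.
move: (r%:R : R) qr r0 zr => s qs s0 zs.
have sp : 0 <= s - (q - z) by lra.
have sm : 0 <= s + (q - z) by lra.
move: (q - z) sp sm => p sp sm.
have := sqr_ge0 (y - p); have := mulr_ge0 sp sm; rewrite !expr2; lra.
Qed.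

(** The Bernstein data [phi j] are values of the derivative [G] near the nodes. Points within [eta]
    of [x] are handled by uniform continuity, the others by 2M times the squared distance over
    eta^2; the sum of both bounds is quadratic, as [bern_estimate] requires. *)
Lemma bernop_partials_approx l w F (e : R) : Ck (size w) setT F -> 0 < e ->
  \forall N \near \oo, forall x, cube a rho x ->
    `|partials w (bernop a rho (rho / N%:R) l N F) x - partials w F x| < e.
Proof.
move=> CF e0; set r := count_mem l w; set G := partials w F.
have cG : continuous G.
  move=> x; apply: (@Ck_continuous _ _ _ 0 setT) => //.
  by apply: Ck_partials; rewrite addn0.
have [M M0 GM] := bounded_on_compact (compact_cube (a := a) (rho := rho)) cG.
have e20 : 0 < e / 2 by rewrite divr_gt0.
have [eta eta0 Geta] :=
  uniformly_continuous_line l (compact_cube (a := a) (rho := rho)) cG e20.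
(* In [K / N], the part with [A] collects the far nodes and the shift of degree by [r]; the part
   with [M] pays for the factor [c] being only close to 1. *)
pose A := M * (rho / eta) ^+ 2.
have A0 : 0 <= A by rewrite mulr_ge0 // sqr_ge0.
pose K := 4 * A * ((r * r)%:R + 1) + (r * r)%:R * M.
near=> N => x xc.
have rN : (r < N)%N by near: N; exact: nbhs_infty_gt.
have N0 : (0 < N)%N by exact: leq_ltn_trans rN.
have NR : 0 < N%:R :> R by rewrite ltr0n.
have KN : K / N%:R < e / 2.
  rewrite ltr_pdivrMr // mulrC -ltr_pdivrMr //.
  by near: N; exact: nbhs_infty_gtr.
rewrite (partials_bernop CF N0 (ltnW rN)) -/r.
set c := \prod_(i < r) _.
have [c0 c1 cN] : [/\ 0 <= c, c <= 1 & 1 - c <= (r * r)%:R / N%:R].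
  exact: prod_falling_bounds (ltnW rN) N0.
rewrite -[(c \*o _) x]/(c * bernop a rho (rho / N%:R) l (N - r) _ x) bernopE.
set phi := (fun j => _); set t := unit_coord a rho l x.
have et : coord l x = a + rho * t.
  rewrite -[t]/(rho^-1 * (coord l x - a)) mulVKf ?gt_eqF //.
  by rewrite addrC subrK.
have t01 : 0 <= t <= 1.
  have := xc l; rewrite et lerDl lerD2l.
  by rewrite pmulr_rge0 // -[X in _ * t <= X]mulr1 ler_pM2l.
have h0 : 0 < rho / N%:R by rewrite divr_gt0.
have eN : N = (N - r + r)%N by rewrite subnK // ltnW.
have Nr1 : (N - r)%:R / N%:R <= 1 :> R.
  by rewrite ler_pdivrMr // mul1r ler_nat leq_subr.
(* The intermediate point stays in the cube: its offset from [a] is at most [N - r] meshes for the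
   node plus [r] for the mean values, in all [rho]. *)
have phiE j : (j <= N - r)%N -> exists2 s : R, cube a rho (reset l s x) /\
     (s - coord l x) ^+ 2 <= (rho / N%:R) ^+ 2 *
       (2 * (j%:R - (N - r)%:R * t) ^+ 2 + 2 * (r * r)%:R) &
     phi j = G (reset l s x).
  move=> jN.
  have Cw : Ck r setT (partials [seq m <- w | m != l] F).
    apply: Ck_partials; apply: Ck_leq CF.
    by rewrite size_filter addnC count_predC.
  have [q q01 eq] := iter_diff_quotE l (reset l (a + j%:R * (rho / N%:R)) x) h0 Cw.
  exists (a + j%:R * (rho / N%:R) + q).
    split.
      move=> m; rewrite coord_reset; case: eqVneq => // _.
      case/andP: q01 => q0 qr; apply/andP; split.
        by rewrite -addrA lerDl addr_ge0 // mulr_ge0 // ltW.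
      rewrite -addrA lerD2l.
      apply: (@le_trans _ _ (j%:R * (rho / N%:R) + r%:R * (rho / N%:R))).
        by rewrite lerD2l.
      rewrite -mulrDl -natrD mulrCA ger_pMr // ler_pdivrMr // mul1r ler_nat.
      by rewrite addnC -leq_subRL ?(ltnW rN).
    have := node_bound j N0 eN t01 q01; rewrite et.
    rewrite (_ : _ + q - rho * t =
      a + j%:R * (rho / N%:R) + q - (a + rho * t)) //; ring.
  rewrite /phi eq reset_line; congr (_ _).
  by rewrite /G (partials_count l CF).
have phi_near j : (j <= N - r)%N -> `|phi j - G x| <=
   (e / 2 + 4 * A * (r * r)%:R / N%:R ^+ 2) +
   (4 * A / N%:R ^+ 2) * (j%:R - (N - r)%:R * t) ^+ 2.
  move=> /phiE[s [sc sx] ->].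
  set Q := (j%:R - _) ^+ 2 in sx *.
  have Q0 : 0 <= Q by exact: sqr_ge0.
  have rest : 4 * A * (r * r)%:R / N%:R ^+ 2 + 4 * A / N%:R ^+ 2 * Q =
     2 * M / eta ^+ 2 * ((rho / N%:R) ^+ 2 * (2 * Q + 2 * (r * r)%:R)).
    by rewrite /A; field; rewrite !gt_eqF.
  rewrite -addrA rest.
  have M1 : 0 <= 2 * M / eta ^+ 2 by apply: divr_ge0; [exact: mulr_ge0 | exact: sqr_ge0].
  have rest0 : 0 <= 2 * M / eta ^+ 2 * ((rho / N%:R) ^+ 2 * (2 * Q + 2 * (r * r)%:R)).
    by apply: mulr_ge0; [exact: M1 | apply: le_trans sx; exact: sqr_ge0].
  have [st|st] := ltP `|s - coord l x| eta.
    have := Geta x _ xc st; rewrite -[x + _]/(reset l s x) => Gs.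
    by apply: le_trans Gs _; rewrite lerDl.
  apply: (@le_trans _ _ (2 * M / eta ^+ 2 * (s - coord l x) ^+ 2)); last first.
    apply: (@le_trans _ _ (2 * M / eta ^+ 2 *
        ((rho / N%:R) ^+ 2 * (2 * Q + 2 * (r * r)%:R)))).
      exact: ler_wpM2l.
    by rewrite lerDr ltW.
  apply: (@le_trans _ _ (2 * M)).
    apply: le_trans (ler_normB _ _) _.
    by rewrite mulrC mulr_natr mulr2n lerD // GM.
  rewrite mulrAC -mulrA ler_peMr ?mulr_ge0 // ler_pdivlMr ?exprn_gt0 // mul1r.
  by rewrite -[(s - _) ^+ 2]real_normK ?num_real // ler_pXn2r // ?nnegrE // ltW.
have C0 : 0 <= 4 * A / N%:R ^+ 2 by apply: divr_ge0; [exact: mulr_ge0 | exact: sqr_ge0].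
have Hb := bern_estimate t01 C0 phi_near.
set b := bern _ _ _ in Hb *.
have Hb' : `|b - G x| <= e / 2 + 4 * A * ((r * r)%:R + 1) / N%:R.
  apply: le_trans Hb _; rewrite -addrA lerD2l.
  have N1 : N%:R^-1 <= 1 :> R by rewrite invf_le1 // ler1n.
  have -> : 4 * A * (r * r)%:R / N%:R ^+ 2 + 4 * A / N%:R ^+ 2 * (N - r)%:R =
     4 * A / N%:R * ((r * r)%:R * N%:R^-1 + (N - r)%:R / N%:R).
    by field; rewrite gt_eqF.
  rewrite [leRHS]mulrAC; apply: ler_wpM2l.
    by apply: divr_ge0; [exact: mulr_ge0 | exact: ltW].
  by rewrite lerD // ler_piMr.
have -> : c * b - G x = c * (b - G x) - (1 - c) * G x by ring.
apply: le_lt_trans (ler_normB _ _) _; rewrite !normrM.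
rewrite (ger0_norm c0) (@ger0_norm _ (1 - c)) ?subr_ge0 //.
have B1 : c * `|b - G x| <= `|b - G x| by rewrite ler_piMl.
have B2 : (1 - c) * `|G x| <= (r * r)%:R / N%:R * M.
  by rewrite ler_pM ?subr_ge0 // GM.
have eK : K / N%:R = 4 * A * ((r * r)%:R + 1) / N%:R + (r * r)%:R / N%:R * M.
  by rewrite /K mulrDl [X in _ + X]mulrAC.
apply: le_lt_trans (lerD (le_trans B1 Hb') B2) _.
by rewrite -addrA -eK [ltRHS]splitr ltrD2l.
Unshelve. all: by end_near. Qed.

Lemma bernop_Ck_approx k l F (e : R) : Ck k setT F -> 0 < e ->
  exists N : nat, forall w x, (size w <= k)%N -> cube a rho x ->
    `|partials w (bernop a rho (rho / N%:R) l N F) x - partials w F x| < e.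
Proof.
move=> CF e0.
pose P N w := forall x, cube a rho x ->
    `|partials w (bernop a rho (rho / N%:R) l N F) x - partials w F x| < e.
have /filter_ex[N HN] : \forall N \near \oo, forall w, (size w <= k)%N -> P N w.
  apply: near_words => w sw; apply: bernop_partials_approx => //.
  exact: Ck_leq CF.
by exists N => w x /HN; apply.
Qed.

End BernsteinApproximation.

(** * C^k approximation by polynomials *)

Section PolynomialApproximation.
Context {R : realType} {n d : nat}.
Notation pt := 'M[R]_(n, d).
Notation dir := (@coord_dir R n d).
Implicit Types (x v : pt) (F G : pt -> R) (l m : 'I_(n * d)).
Implicit Types (s : seq 'I_(n * d)).

(* Polynomials in the coordinates listed in [s], with coefficients that are
   functions of the remaining coordinates. *)
Inductive poly_in s : (pt -> R) -> Prop :=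
| poly_in_indep F : (forall l x (t : R), l \in s -> F (x + t *: dir l) = F x) ->
    poly_in s F
| poly_in_coord l : poly_in s (coord l)
| poly_in_add F G : poly_in s F -> poly_in s G -> poly_in s (F + G)
| poly_in_mul F G : poly_in s F -> poly_in s G -> poly_in s (F * G).

Lemma poly_in_cst s (c : R) : poly_in s (cst c).
Proof. exact: poly_in_indep. Qed.

Lemma poly_in_translate s v F : poly_in s F -> poly_in s (translate v F).
Proof.
elim=> {F} [F Fs|l|F G _ IF _ IG|F G _ IF _ IG].
- by apply: poly_in_indep => l x t /Fs H; rewrite /translate /= addrAC H.
- have -> : translate v (coord l) = coord l + cst (coord l v).
    by apply/funext => x; rewrite /translate /coord /= linearD mxE.
  by apply: poly_in_add; [exact: poly_in_coord | exact: poly_in_cst].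
- exact: poly_in_add IF IG.
- exact: poly_in_mul IF IG.
Qed.

Lemma poly_in_reset s l (a : R) F :
  poly_in s F -> poly_in (l :: s) (F \o reset l a).
Proof.
elim=> {F} [F Fs|m|F G _ IF _ IG|F G _ IF _ IG].
- apply: poly_in_indep => m x t; rewrite inE /= resetD.
  case: eqVneq => [_ _|_ /= ms]; first by rewrite mulr0 scale0r addr0.
  by rewrite Fs.
- have [->|ml] := eqVneq m l.
    have -> : coord l \o reset l a = cst a.
      by apply/funext => x /=; rewrite coord_reset eqxx.
    exact: poly_in_cst.
  have -> : coord m \o reset l a = coord m.
    by apply/funext => x /=; rewrite coord_reset (negPf ml).
  exact: poly_in_coord.
- exact: poly_in_add IF IG.
- exact: poly_in_mul IF IG.
Qed.

Lemma poly_in_bernop s (a rho h : R) l N F :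
  poly_in s F -> poly_in (l :: s) (bernop a rho h l N F).
Proof.
have pu : poly_in (l :: s) (unit_coord a rho l : pt -> R).
  have -> : unit_coord a rho l = cst rho^-1 * (coord l + cst (- a)) by [].
  apply: poly_in_mul; first exact: poly_in_cst.
  by apply: poly_in_add; [exact: poly_in_coord | exact: poly_in_cst].
elim: N F => [|N IH] F pF /=; first exact: poly_in_reset.
apply: poly_in_add; apply: poly_in_mul => //; last exact/IH/poly_in_translate.
  have -> : cst 1 - unit_coord a rho l = cst 1 + cst (-1) * unit_coord a rho l.
    by apply/funext => x; rewrite -[RHS]/(1 + -1 * _) mulN1r.
  apply: poly_in_add; first exact: poly_in_cst.
  by apply: poly_in_mul => //; exact: poly_in_cst.
exact: IH.
Qed.

(** Once [s] lists every coordinate, a coefficient independent of [s] is constant: deleting the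
    terms of [sum_coord] one by one moves [x] to 0. *)
Lemma poly_inP s F : (forall l, l \in s) -> poly_in s F ->
  exists P : mpoly.mpoly (n * d) R, F = poly_fun P.
Proof.
move=> sT; elim=> {F} [F Fs|l|F G _ [P ->] _ [Q ->]|F G _ [P ->] _ [Q ->]].
- exists (mpoly.mpolyC (n * d) (F 0)); apply/funext => x.
  rewrite /poly_fun mpoly.mevalC [in LHS](sum_coord x).
  elim/big_rec : _ => // l y _ <-.
  by rewrite addrC Fs.
- exists (mpoly.mpolyX R (mpoly.mnm1 l)); apply/funext => x.
  by rewrite /poly_fun mpoly.mevalXU.
- by exists (P + Q); apply/funext => x; rewrite /poly_fun mpoly.mevalD.
- by exists (P * Q); apply/funext => x; rewrite /poly_fun mpoly.mevalM.
Qed.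

Lemma poly_Ck_approx k F (a rho e : R) : 0 < rho -> 0 < e -> Ck k setT F ->
  exists P : mpoly.mpoly (n * d) R, Ck k setT (poly_fun P : pt -> R) /\
    forall w x, (size w <= k)%N -> cube a rho x ->
      `|partials w (poly_fun P) x - partials w F x| < e.
Proof.
move=> rho0 e0 CF.
suff [G [CG pG GF]] : exists G, [/\ Ck k setT G, poly_in (enum 'I_(n * d)) G &
    forall w x, (size w <= k)%N -> cube a rho x ->
      `|partials w G x - partials w F x| < e].
  have [|P eP] := poly_inP _ pG; first by move=> l; rewrite mem_enum.
  by exists P; rewrite -eP.
(* The error is generalized because each new coordinate takes half of it; the operator in [l]
   preserves polynomiality in the coordinates already treated. *)
elim: (enum 'I_(n * d)) e e0 => [|l s IH] e e0.
  exists F; split=> // [|w x _ _]; last by rewrite subrr normr0.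
  exact: poly_in_indep.
have e20 : 0 < e / 2 by rewrite divr_gt0.
have [G [CG pG GF]] := IH _ e20.
have [N HN] := bernop_Ck_approx a rho0 l CG e20.
exists (bernop a rho (rho / N%:R) l N G).
split; [exact: Ck_bernop | exact: poly_in_bernop |] => w x sw xc.
apply: le_lt_trans (ler_distD (partials w G x) _ _) _.
by rewrite [ltRHS]splitr ltrD // ?HN // GF.
Qed.

End PolynomialApproximation.

(** * Global extension of C^k functions *)

Section Extension.
Context {R : realType}.

(** The truncated power has enough derivatives for a C^k cutoff; starting from exponent 2 makes even
    the first one differentiable with continuous derivative. *)
Definition pos_pow (m : nat) (t : R) : R := Num.max 0 t ^+ m.+2.

Lemma pos_pow_ge0 m t : 0 <= pos_pow m t.
Proof. by rewrite exprn_ge0 // le_max lexx. Qed.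

Lemma pos_pow_gt0 m t : 0 < t -> 0 < pos_pow m t.
Proof. by move=> t0; rewrite exprn_gt0 // lt_max t0 orbT. Qed.

Lemma pos_pow_eq0 m t : t <= 0 -> pos_pow m t = 0.
Proof. by move=> t0; rewrite /pos_pow max_l // expr0n. Qed.

Lemma pos_pow1 m : pos_pow m 1 = 1.
Proof. by rewrite /pos_pow max_r ?expr1n. Qed.

Lemma is_derive_quadratic (f : R -> R) (a c : R) :
  (forall h, `|f (h + a) - f a - c * h| <= h ^+ 2) -> is_derive a 1 f c.
Proof.
move=> Hf.
have H : (fun h => h^-1 *: ((f \o shift a) (h *: 1) - f a)) @ (0 : R)^' --> c.
  apply/cvgrPdist_le => e e0; near=> h.
  have h0 : h != 0 by near: h; exact: nbhs_dnbhs_neq.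
  have he : `|h| <= e.
    near: h; apply: dnbhs0_le; exact: e0.
  have -> : (f \o shift a) (h *: 1) = f (h + a) by rewrite /= [_%:A]mulr1.
  rewrite -[_ *: _]/(_ * _).
  have -> : c - h^-1 * (f (h + a) - f a) = - (h^-1 * (f (h + a) - f a - c * h)).
    by field.
  rewrite normrN normrM normfV ler_pdivrMl ?normr_gt0 //.
  apply: le_trans (Hf h) _.
  by rewrite -real_normK ?num_real // expr2 ler_wpM2l.
split; first by apply/cvg_ex; exists c.
exact: cvg_lim H.
Unshelve. all: by end_near. Qed.

Lemma is_derive_pos_pow m (t : R) :
  is_derive t 1 (pos_pow m) (m.+2%:R * Num.max 0 t ^+ m.+1).
Proof.
elim: m => [|m IH].
  (* The corner at 0 is settled here for the square, by the signs of [t] and [h + t]; higher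
     exponents follow from the product rule. *)
  apply: is_derive_quadratic => h; rewrite /pos_pow expr1.
  have [t0|t0] := leP t 0; have [th|th] := leP (h + t) 0; rewrite ler_norml !expr2.
  - have := sqr_ge0 h; rewrite expr2; lra.
  - have : 0 <= - t * (2 * (h + t) - t) by apply: mulr_ge0; lra.
    have := sqr_ge0 (h + t); have := sqr_ge0 h; rewrite !expr2; lra.
  - have : 0 <= t * (- 2 * (h + t) + t) by apply: mulr_ge0; lra.
    have := sqr_ge0 (h + t); rewrite !expr2; lra.
  - have := sqr_ge0 h; rewrite expr2; lra.
have e : pos_pow m.+1 = (@id R) * pos_pow m.
  apply/funext => s; rewrite -[RHS]/(s * pos_pow m s) /pos_pow.
  have [s0|s0] := leP s 0; last by rewrite exprS.
  by rewrite !expr0n mulr0.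
rewrite e; apply: is_derive_eq; rewrite -![_ *: _]/(_ * _) /pos_pow /=.
have [t0|t0] := leP t 0; first by rewrite !expr0n /= !mulr0 mul0r addr0.
rewrite mulr1 !exprS -[m.+3%:R]natr1.
by move: (m.+2%:R : R) (t ^+ m) => p q; ring.
Qed.

Lemma continuous_pos_pow m : continuous (pos_pow m).
Proof.
move=> t; apply: differentiable_continuous; apply/derivable1_diffP.
exact: (@ex_derive _ _ _ _ _ _ _ (is_derive_pos_pow m t)).
Qed.

Context {n d : nat}.
Notation pt := 'M[R]_(n, d).
Notation dir := (@coord_dir R n d).
Implicit Types (x v : pt) (F G : pt -> R) (l m : 'I_(n * d)) (U V K : set pt).

Lemma Ck_pos_pow (k m : nat) G : (k <= m)%N -> Ck k setT G ->
  Ck k setT (pos_pow m \o G).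
Proof.
elim: k m G => [|k IH] [|m] G km CG //.
- split=> // x _; apply: continuous_comp; last exact: continuous_pos_pow.
  exact: (Ck_continuous CG I).
- split=> // x _; apply: continuous_comp; last exact: continuous_pos_pow.
  exact: (Ck_continuous CG I).
apply: (@CkSP _ _ _ _ _ _ (fun l => (m.+3%:R \*o (pos_pow m \o G)) * partial l G)).
- exact: openT.
- move=> x _; apply: continuous_comp; last exact: continuous_pos_pow.
  exact: (Ck_continuous CG I).
- move=> l x _; have /derivative_line0 dG := Ck_derivable l CG (I : setT x).
  apply/derivative_line0.
  apply: (@is_derive1_comp _ (pos_pow m.+1) (fun s => G (x + s *: dir l)) 0 _ _ _ dG).
  by rewrite scale0r addr0; exact: is_derive_pos_pow.
move=> l; apply: CkM; [exact: openT | | exact: Ck_partial].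
by apply: CkZ; [exact: openT | apply: IH => //; exact: Ck_pred].
Qed.

(* [1 - pos_pow k (1 - S)] is then a cutoff function: it is [1] on [V] and [0]
   on [W]. *)
Definition separated k U V := exists S W,
  [/\ Ck k setT S, forall y, 0 <= S y, forall y, V y -> 1 <= S y,
      open W & (forall y, W y -> S y = 0) /\ U `|` W = setT].

Lemma separated0 k U : separated k U set0.
Proof.
exists (cst 0), setT; split=> //; first exact/Ck_cst/openT.
- exact: openT.
- by rewrite setUT.
Qed.

Lemma separatedU k U V V' :
  separated k U V -> separated k U V' -> separated k U (V `|` V').
Proof.
move=> [S [W [CS S0 S1 oW [SW UW]]]] [S' [W' [CS' S0' S1' oW' [SW' UW']]]].
exists (S + S'), (W `&` W'); split.
- by apply: CkD => //; exact: openT.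
- by move=> y; rewrite -[leRHS]/(S y + S' y) addr_ge0.
- move=> y; rewrite -[leRHS]/(S y + S' y) => -[/S1|/S1'] H.
    by rewrite -[1]addr0 lerD.
  by rewrite -[1]add0r lerD.
- exact: openI.
split=> [y [/SW Sy /SW' Sy']|]; first by rewrite -[LHS]/(S y + S' y) Sy Sy' addr0.
by rewrite setUIr UW UW' setIT.
Qed.

(** [G] is (r/2)^2 minus the squared Euclidean distance to [x], so it is nonnegative only inside
    [U]; its truncated power vanishes on the open set where [G] is negative. *)
Lemma separated_nbhs k U x : open U -> U x ->
  exists2 V, open V & V x /\ separated k U V.
Proof.
move=> oU Ux.
have /nbhs_ballP[r /= r0 rU] : nbhs x U by exact: open_nbhs_nbhs.
pose T l : pt -> R := (coord l - cst (coord l x)) * (coord l - cst (coord l x)).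
pose G : pt -> R := cst ((r / 2) ^+ 2) - \sum_l T l.
have oT := @openT pt.
have GE y : G y = (r / 2) ^+ 2 - \sum_l (coord l y - coord l x) ^+ 2.
  rewrite -[LHS]/(_ - (\sum_l T l) y).
  by rewrite fct_sumE.
have CG k' : Ck k' setT G.
  apply: CkB => //; first exact: Ck_cst.
  apply: Ck_sum => // l _.
  by apply: CkM => //; apply: CkB => //; by [exact: Ck_coord | exact: Ck_cst].
have Gball y : 0 <= G y -> U y.
  move=> Gy; apply: rU; split=> // i j.
  have r20 : 0 <= r / 2 by rewrite divr_ge0 // ltW.
  have : (coord (mxvec_index i j) y - coord (mxvec_index i j) x) ^+ 2 <= (r / 2) ^+ 2.
    apply: le_trans (_ : \sum_l (coord l y - coord l x) ^+ 2 <= _); last first.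
      by move: Gy; rewrite GE subr_ge0.
    rewrite (bigD1 (mxvec_index i j)) //= lerDl.
    by apply: sumr_ge0 => l _; exact: sqr_ge0.
  rewrite /coord !mxvecE -[X in X <= _]real_normK ?num_real //.
  rewrite ler_pXn2r ?nnegrE // => H.
  rewrite /ball /= distrC; apply: le_lt_trans H _.
  by rewrite ltr_pdivrMr // ltr_pMr // ltr1n.
have Gx : 0 < G x.
  rewrite GE big1 ?subr0 ?exprn_gt0 ?divr_gt0 // => l _.
  by rewrite subrr expr0n.
(* This makes [S x] equal to 2, so that [S > 1] defines an open neighbourhood of [x]. *)
pose c := 2 / pos_pow k (G x).
have c0 : 0 < c by rewrite divr_gt0 // pos_pow_gt0.
pose S := c \*o (pos_pow k \o G).
have CS : Ck k setT S by apply: CkZ => //; exact: Ck_pos_pow.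
have cont (H : pt -> R) : Ck 0 setT H -> continuous H.
  by move=> CH y; exact: Ck_continuous CH _ I.
exists [set y | 1 < S y].
  apply: (@open_comp _ _ S [set t | 1 < t]); last exact: open_gt.
  by move=> y _; apply: cont; exact: Ck_leq CS.
split; first by rewrite /S /= /c divfK ?ltr1n // gt_eqF // pos_pow_gt0.
exists S, [set y | G y < 0]; split=> //.
- by move=> y; rewrite mulr_ge0 ?pos_pow_ge0 // ltW.
- by move=> y /ltW.
- apply: (@open_comp _ _ G [set t | t < 0]); last exact: open_lt.
  by move=> y _; exact: cont.
split=> [y /ltW Gy|]; first by rewrite /S /= pos_pow_eq0 // mulr0.
apply/seteqP; split=> // y _; have [/Gball|] := leP 0 (G y); first by left.
by right.
Qed.

Lemma Ck_extend k U K F : compact K -> open U -> K `<=` U -> Ck k U F ->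
  exists2 F', Ck k setT F' & forall x, K x -> F' x = F x.
Proof.
move=> cK oU KU CF.
suff [S [W [CS S0 S1 oW [SW UW]]]] : separated k U K.
  pose chi := cst 1 - (pos_pow k \o (cst 1 - S)).
  have oT := @openT pt.
  have Cchi : Ck k setT chi.
    apply: CkB => //; first exact: Ck_cst.
    by apply: Ck_pos_pow => //; apply: CkB => //; exact: Ck_cst.
  pose F' y := if `[< U y >] then chi y * F y else 0.
  exists F'.
    (* [U] and [W] cover the space: on [U] the extension is [chi * F], on [W] it is 0 because [chi]
       vanishes there. *)
    rewrite -UW; apply: Ck_setU.
      apply: (@Ck_eq _ _ _ _ _ (chi * F)) => //.
        by move=> y; rewrite inE /F' => Uy; rewrite asboolT.
      by apply: CkM => //; exact: Ck_subset Cchi.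
    apply: (@Ck_eq _ _ _ _ _ (cst 0)) => //; last exact: Ck_cst.
    move=> y; rewrite inE /F' => Wy; case: ifP => // _.
    rewrite -[chi y]/(1 - pos_pow k (1 - S y)) (SW _ Wy) subr0 pos_pow1.
    by rewrite subrr mul0r.
  move=> x Kx; rewrite /F' asboolT; last exact: KU.
  rewrite -[chi x]/(1 - pos_pow k (1 - S x)) pos_pow_eq0.
    by rewrite subr0 mul1r.
  by rewrite subr_le0 S1.
(* Points outside [U] get a dummy set, so that [choice] yields a total function; a finite subcover
   of [K] then suffices. *)
have HV x : exists V, U x -> [/\ open V, V x & separated k U V].
  have [Ux|nUx] := pselect (U x); last by exists set0.
  by have [V oV [Vx sV]] := separated_nbhs k oU Ux; exists V.
have [V HVx] := choice HV.
have [D DK KD] : finite_subset_cover K V K.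
  move: cK; rewrite compact_cover; apply.
    by move=> x /KU/HVx[].
  by move=> x Kx; exists x => //; have [] := HVx _ (KU _ Kx).
have : separated k U (\big[setU/set0]_(x <- finmap.enum_fset D) V x).
  rewrite big_seq; elim/big_ind : _ => [|A B|x xD].
  - exact: separated0.
  - exact: separatedU.
  - by have := DK _ xD; rewrite inE => /KU/HVx[].
rewrite -bigcup_fset => -[S [W [CS S0 S1 oW SW]]].
by exists S, W; split=> // y /KD; exact: S1.
Qed.

End Extension.

(** * Averaging over the group *)

Section Symmetrization.
Context {R : realType} {n d : nat}.
Notation pt := 'M[R]_(n, d).
Notation dir := (@coord_dir R n d).
Implicit Types (x : pt) (F : pt -> R) (l m : 'I_(n * d)) (s : {ffun 'I_n -> 'I_n}).

Lemma mderiv_partials (k : nat) (a : mpoly.bmultinom (n * d) k.+1) :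
  exists2 w : seq 'I_(n * d), (size w <= k)%N & forall F, mderiv a F = partials w F.
Proof.
exists (flatten [seq nseq (a l) l | l <- enum 'I_(n * d)]).
  (* [bmultinom] with bound [k.+1] means degree strictly below [k.+1], which is the length bound
     [k]. *)
  rewrite -ltnS; apply: leq_ltn_trans (mpoly.bmdeg a).
  suff -> : size (flatten [seq nseq (a l) l | l <- enum 'I_(n * d)]) =
      (\sum_(l <- enum 'I_(n * d)) a l)%N by rewrite big_enum /= -mpoly.mdegE.
  elim: (enum _) => [|l s IH] /=; first by rewrite big_nil.
  by rewrite size_cat size_nseq big_cons IH.
move=> F; rewrite /mderiv /partials; elim: (enum _) => //= l s IH.
by rewrite foldr_cat IH; elim: (a l) => //= j ->.
Qed.

Lemma partialsD w F H : Ck (size w) setT F -> Ck (size w) setT H ->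
  partials w (F + H) = partials w F + partials w H.
Proof.
elim: w => //= l w IH CF CH; rewrite IH; [|exact: Ck_pred|exact: Ck_pred].
by apply: partialD; apply: Ck_partials; rewrite addn1.
Qed.

Lemma partialsZ w (c : R) F : Ck (size w) setT F ->
  partials w (c \*o F) = c \*o partials w F.
Proof.
elim: w => //= l w IH CF; rewrite IH; last exact: Ck_pred.
by apply: partialZ; apply: Ck_partials; rewrite addn1.
Qed.

Lemma partialsB w F H : Ck (size w) setT F -> Ck (size w) setT H ->
  partials w (F - H) = partials w F - partials w H.
Proof.
elim: w => //= l w IH CF CH; rewrite IH; [|exact: Ck_pred|exact: Ck_pred].
by apply: partialB; apply: Ck_partials; rewrite addn1.
Qed.

Lemma partials_sum (I : Type) (r : seq I) (P : pred I) (F : I -> pt -> R) w :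
  (forall i, Ck (size w) setT (F i)) ->
  partials w (\sum_(i <- r | P i) F i) = \sum_(i <- r | P i) partials w (F i).
Proof.
move=> CF; have oT := @openT pt; elim: r => [|i r IH].
  rewrite !big_nil; have -> : (0 : pt -> R) = 0 \*o (0 : pt -> R).
    by apply/funext => x /=; rewrite mul0r.
  rewrite partialsZ; first by apply/funext => x /=; rewrite !mul0r.
  exact: Ck_cst.
rewrite !big_cons; case: ifP => // Pi; rewrite partialsD ?IH //.
by apply: Ck_sum.
Qed.

Lemma continuous_rowsub s : continuous (rowsub s : pt -> pt).
Proof.
move=> x U /nbhs_ballP[e e0 eU]; apply/nbhs_ballP; exists e => // y [_ xy].
by apply: eU; split=> // i j; rewrite !mxE; apply: xy.
Qed.

Lemma rowsub_dir s : bijective s ->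
  exists p : 'I_(n * d) -> 'I_(n * d), forall x (t : R) m,
    rowsub s (x + t *: dir m) = rowsub s x + (t * (predT m)%:R) *: dir (p m).
Proof.
move=> [s' sK s'K].
suff /choice[p Hp] m : exists m', rowsub s (dir m) = dir m' :> pt.
  exists p => x t m; rewrite mulr1 -Hp.
  by apply/matrixP => i j; rewrite !mxE.
rewrite /coord_dir; case: (mxvec_indexP m) => i j.
(* Row [i'] of [rowsub s x] is row [s i'] of [x], so a unit entry in row [i] moves to row [s' i]. *)
exists (mxvec_index (s' i) j); apply/matrixP => i' j'; rewrite !vec_mx_delta !mxE.
by rewrite (can2_eq sK s'K).
Qed.

Lemma partials_rowsub s w : bijective s ->
  exists2 w', size w' = size w &
    forall F, partials w (F \o rowsub s) = partials w' F \o rowsub s.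
Proof.
move=> /rowsub_dir[p Hp]; exists (map p w); first by rewrite size_map.
move=> F; elim: w => //= l w ->.
rewrite (partial_affine Hp); apply/funext => x.
by rewrite /= mul1r.
Qed.

Lemma Ck_rowsub k s F : bijective s -> Ck k setT F -> Ck k setT (F \o rowsub s).
Proof.
move=> /rowsub_dir[p Hp].
apply: (@Ck_affine _ _ _ (rowsub s) predT p); last exact: Hp.
exact: continuous_rowsub.
Qed.

Lemma poly_fun_rowsub (P : mpoly.mpoly (n * d) R) s :
  exists Q : mpoly.mpoly (n * d) R, poly_fun Q = poly_fun P \o rowsub s.
Proof.
have /choice[p Hp] l : exists l', forall x, coord l (rowsub s x) = coord l' x.
  case: (mxvec_indexP l) => i j; exists (mxvec_index (s i) j) => x.
  by rewrite /coord !mxvecE mxE.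
exists (\sum_(m <- mpoly.msupp P) mpoly.mcoeff m P *:
  \prod_l (mpoly.mpolyX R (mpoly.mnm1 (p l))) ^+ m l).
apply/funext => x; rewrite /poly_fun /= [RHS]mpoly.mevalE raddf_sum /=.
apply: eq_bigr => m _; rewrite mpoly.mevalZ rmorph_prod; congr (_ * _).
apply: eq_bigr => l _; rewrite rmorphXn /= mpoly.mevalXU; congr (_ ^+ _).
by rewrite -[RHS]/(coord l (rowsub s x)) Hp.
Qed.

Lemma poly_fun_mean (I : finType) (A : pred I) (c : R)
    (Q : I -> mpoly.mpoly (n * d) R) :
  poly_fun (c *: \sum_(i | A i) Q i) = c \*o \sum_(i | A i) poly_fun (Q i) :> (pt -> R).
Proof.
by apply/funext => x; rewrite /poly_fun mpoly.mevalZ raddf_sum /= fct_sumE.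
Qed.

Lemma rowsub_comp (g h : 'I_n -> 'I_n) x :
  rowsub h (rowsub g x) = rowsub (g \o h) x.
Proof. by apply/matrixP => i j; rewrite !mxE. Qed.

Variables (G : topologicalGroupType) (act : G -> 'I_n -> 'I_n).
Hypothesis hact : is_group_action act.

(** Averaging over this finite set of maps takes the place of integration against Haar measure on
    [G]. *)
Definition act_image : pred {ffun 'I_n -> 'I_n} :=
  fun s => `[< exists g, s =1 act g >].

Lemma act_image_bij s : act_image s -> bijective s.
Proof.
move=> /asboolP[g sg]; exists (act g^-1%g) => i; rewrite sg -(act_mul hact).
  by rewrite mulVg (act_one hact).
by rewrite mulgV (act_one hact).
Qed.

(** The two row operations compose to the one of [act g \o s], and left multiplication by [g]
    permutes the image of [G]. *)
Lemma sum_act_image_rowsub F g x :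
  \sum_(s | act_image s) F (rowsub s (rowsub (act g) x)) =
  \sum_(s | act_image s) F (rowsub s x).
Proof.
pose h g' s : {ffun 'I_n -> 'I_n} := [ffun i => act g' (s i)].
have hK g1 g2 : (g1 * g2 = 1)%g -> cancel (h g2) (h g1).
  by move=> g12 s; apply/ffunP => i; rewrite !ffunE -(act_mul hact) g12 (act_one hact).
have hA g' s : act_image s -> act_image (h g' s).
  move=> /asboolP[g1 sg1]; apply/asboolP; exists (g' * g1)%g => i.
  by rewrite ffunE sg1 (act_mul hact).
have h1 := hK _ _ (mulVg g); have h2 := hK _ _ (mulgV g).
rewrite [RHS](reindex (h g)); last by exists (h g^-1%g) => s _; [exact: h1 | exact: h2].
apply: eq_big => s.
  by apply/idP/idP => [/(hA g)//|/(hA g^-1%g)]; rewrite h1.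
move=> _; rewrite rowsub_comp; congr (F _).
by apply/matrixP => i j; rewrite !mxE ffunE.
Qed.

Lemma act_image_gt0 : (0 < #|act_image|)%N.
Proof.
apply/card_gt0P; exists [ffun i => act 1%g i]; apply/asboolP.
by exists 1%g => i; rewrite ffunE.
Qed.

End Symmetrization.

(** * Norm estimate and proof of the approximation theorem *)

Lemma Ck_norm_le (R : realType) (n d k : nat) (V : set 'M[R]_(n, d))
    (p F : 'M[R]_(n, d) -> R) U (e : R) : 0 <= e -> Ck_extension k V p U F ->
  (forall w x, (size w <= k)%N -> V x -> `|partials w F x| <= e) ->
  Ck_norm k V p <= #|{: mpoly.bmultinom (n * d) k.+1}|%:R * e.
Proof.
move=> e0 eF Fe.
(* An empty or unbounded set has [sup] 0 by default. Hence all sums in the infimum are nonnegative,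
   the lower bound that [ge_inf] asks for. *)
have sup_ge0 (E : set R) : (forall y, E y -> 0 <= y) -> 0 <= sup E.
  move=> E0; have [hE|nE] := pselect (has_sup E); last by rewrite sup_out.
  have [[y Ey] uE] := hE; apply: le_trans (E0 _ Ey) _.
  exact: ub_le_sup.
apply: (@le_trans _ _ (sum_max_deriv k V F)).
  apply: ge_inf; last by exists U, F.
  exists 0 => _ [U' [F' [_ ->]]]; apply: sumr_ge0 => a _.
  by apply: sup_ge0 => _ [x _ <-].
rewrite /sum_max_deriv mulr_natl -sumr_const; apply: ler_sum => a _.
have [V0|V0] := pselect (V !=set0); last first.
  rewrite (_ : [set _ | _ in _] = set0) ?sup0 //.
  by rewrite -subset0 => y [x Vx _]; case: V0; exists x.
apply: ge_sup; first by case: V0 => x Vx; exists `|mderiv a F x|; exists x.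
have [w wk we] := @mderiv_partials R n d k a.
by move=> _ [x Vx <-]; rewrite we; exact: Fe.
Qed.

Lemma compact_set_pow_cube (R : realType) (n d : nat) (Omega : set 'rV[R]_d) :
  compact Omega ->
  compact (set_pow Omega : set 'M[R]_(n, d)) /\
  exists2 B : R, 0 < B & @set_pow R n d Omega `<=` cube (- B) (B + B).
Proof.
move=> cO.
have [B B0 HB] : exists2 B : R, 0 < B & @set_pow R n d Omega `<=` cube (- B) (B + B).
  have /choice[M HM] (j : 'I_d) : exists M : R, 0 <= M /\
      forall y, Omega y -> `|y 0 j| <= M.
    have [M M0 HM] := @bounded_on_compact R 1 d (fun y => y 0 j) Omega cO
      (@coord_continuous _ _ _ 0 j).
    by exists M.
  have S0 (P : pred 'I_d) : 0 <= \sum_(j | P j) M j.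
    by apply: sumr_ge0 => j _; have [] := HM j.
  exists (1 + \sum_j M j); first by rewrite ltr_pwDl.
  move=> x Kx l; rewrite /coord; case: (mxvec_indexP l) => i j; rewrite mxvecE.
  rewrite addKr -ler_norml.
  have [_ /(_ _ (Kx i))] := HM j; rewrite mxE => H; apply: le_trans H _.
  by rewrite (bigD1 j) //= addrCA lerDl addr_ge0.
split; last by exists B.
apply: (@subclosed_compact _ _ _ _ (@compact_cube R n d (- B) (B + B)) HB).
have -> : @set_pow R n d Omega = \bigcap_i (row i @^-1` Omega).
  by apply/seteqP; split=> [x Kx i _|x Kx i]; exact: Kx.
apply: closed_bigI => i _.
have cr : continuous (row i : 'M[R]_(n, d) -> 'rV[R]_d).
  move=> x U /nbhs_ballP[e e0 eU]; apply/nbhs_ballP; exists e => // y [_ xy].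
  by apply: eU; split=> // i' j; rewrite !mxE; apply: xy.
move/continuous_closedP : cr; apply.
by apply: compact_closed => //; exact: norm_hausdorff.
Qed.

Theorem theorem9 (R : realType) (n d k : nat) (hn : (2 <= n)%N) (hd : (1 <= d)%N)
    (Omega : set 'rV[R]_d) (hOmega : compact Omega)
    (G : topologicalGroupType) (hG : compact [set: G])
    (act : G -> 'I_n -> 'I_n) (hact : is_group_action act)
    (f : 'M[R]_(n, d) -> R)
    (finv : G_invariant act (set_pow Omega) f)
    (fCk : Ck_on k (set_pow Omega) f)
    (eps : R) (heps : 0 < eps) :
  exists P : mpoly.mpoly (n * d) R,
    G_invariant act [set: 'M[R]_(n, d)] (poly_fun P) /\
    Ck_norm k (set_pow Omega) (fun x => f x - poly_fun P x) < eps.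
Proof.
set K := set_pow Omega in finv fCk *.
have [cK [B B0 KB]] := @compact_set_pow_cube R n d Omega hOmega.
have [U [F0 [oU KU CF0 F0f]]] := fCk.
have [F CF FF0] := Ck_extend cK oU KU CF0.
have Ff x : K x -> F x = f x by move=> Kx; rewrite FF0 // F0f.
pose C := #|{: mpoly.bmultinom (n * d) k.+1}|.
(* The norm will be at most [C * e]; the added 1 makes this strictly less than [eps]. *)
pose e := eps / (C%:R + 1).
have C0 : 0 < C%:R + 1 :> R by rewrite ltr_wpDl.
have e0 : 0 < e by rewrite divr_gt0.
have [Q [CQ QF]] := poly_Ck_approx (- B) (addr_gt0 B0 B0) e0 CF.
pose A := act_image act; pose N := #|A|.
have NR : 0 < N%:R :> R by rewrite ltr0n; exact: act_image_gt0.
have [Qs HQs] := choice (poly_fun_rowsub Q).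
pose P := N%:R^-1 *: \sum_(s | A s) Qs s.
have PE x : poly_fun P x = N%:R^-1 * \sum_(s | A s) poly_fun Q (rowsub s x).
  rewrite /P poly_fun_mean /= fct_sumE; congr (_ * _).
  by apply: eq_bigr => s _; rewrite HQs.
exists P; split.
  by move=> g x _; rewrite !PE (sum_act_image_rowsub hact).
pose E := F - poly_fun Q.
have oT := @openT 'M[R]_(n, d).
have CE : Ck k setT E by exact: CkB.
(* The value 0 off the image of [G] makes every [Es s] smooth, as [partials_sum] demands; a map that
   is not bijective could break [Ck_rowsub]. *)
pose Es s : 'M[R]_(n, d) -> R := if A s then E \o rowsub s else cst 0.
have CEs s : Ck k setT (Es s).
  rewrite /Es; case: ifP => As; last exact: Ck_cst.
  by apply: Ck_rowsub => //; exact: act_image_bij As.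
pose M := N%:R^-1 \*o \sum_(s | A s) Es s.
have KA s x : A s -> K x -> K (rowsub s x).
  by move=> _ Kx i; have := Kx (s i); congr (Omega _); apply/rowP => j; rewrite !mxE.
have fA s x : A s -> K x -> f (rowsub s x) = f x.
  move=> /asboolP[g sg] Kx; rewrite -(finv g x Kx); congr (f _).
  by apply/matrixP => i j; rewrite !mxE sg.
(* On [K], which is stable under the action, [F] composed with [rowsub s] equals [f] by invariance,
   so averaging leaves [f] unchanged. *)
have Mext : Ck_extension k K (fun x => f x - poly_fun P x) setT M.
  split=> //; first by apply: CkZ => //; exact: Ck_sum.
  move=> x Kx; rewrite PE /M /= fct_sumE.
  rewrite (eq_bigr (fun s : {ffun 'I_n -> 'I_n} =>
    f x - poly_fun Q (rowsub s x))); last first.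
    move=> s As; rewrite /Es As -[LHS]/(F _ - poly_fun Q _) Ff ?fA //.
    exact: KA.
  rewrite sumrB sumr_const mulrBr; congr (_ - _).
  by rewrite -[f x *+ _]mulr_natl mulKf // gt_eqF.
have Me w x : (size w <= k)%N -> K x -> `|partials w M x| <= e.
  move=> wk Kx; have CEw s : Ck (size w) setT (Es s) by exact: Ck_leq (CEs s).
  rewrite /M partialsZ; last exact: Ck_sum.
  rewrite partials_sum //= fct_sumE normrM.
  rewrite (ger0_norm (_ : 0 <= N%:R^-1)) ?invr_ge0 //.
  rewrite ler_pdivrMl //; apply: le_trans (ler_norm_sum _ _ _) _.
  rewrite mulr_natl -sumr_const; apply: ler_sum => s As.
  have [w' sw' Hw'] := @partials_rowsub R n d s w (act_image_bij hact As).
  rewrite /Es As Hw' /= /E partialsB ?sw'; [|exact: Ck_leq CF|exact: Ck_leq CQ].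
  rewrite -[(_ - _) _]/(partials w' F _ - partials w' (poly_fun Q) _) distrC.
  by apply/ltW/QF; [rewrite sw' | exact/KB/KA].
apply: le_lt_trans (Ck_norm_le (ltW e0) Mext Me) _.
by rewrite /e mulrA ltr_pdivrMr // mulrC ltr_pM2l // ltrDl.
Qed.
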